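(* Let $m>1$ and let $(V_\delta,R_\delta,\sigma_\delta)_{0<\delta<1}$ be a high-energy family of solitary waves (as defined in the context) with associated parameters $\varepsilon_\delta,\mu_\delta$. Let $J_\delta:=[-\tfrac{1}{2\mu_\delta},\tfrac{1}{2\mu_\delta}]$ and $$\tilde T_\delta(\tilde x):=\frac{R_\delta(-1+\mu_\delta\tilde x)}{\varepsilon_\delta},\qquad \tilde T_0(\tilde x):=\tfrac12\big(\tilde S_0(\tilde x)+\bar\mu\,\tilde x+\bar\kappa\big).$$ Then there is a constant $C$ independent of $\delta$ such that $$\sup_{\tilde x\in J_\delta}\Big(\varepsilon_\delta^2\big|\tilde T_\delta(\tilde x)-\tilde T_0(\tilde x)\big|+\varepsilon_\delta\big|\tilde T_\delta'(\tilde x)-\tilde T_0'(\tilde x)\big|+\big|\tilde T_\delta''(\tilde x)-\tilde T_0''(\tilde x)\big|\Big)\le C\varepsilon_\delta^{m+1}.$$ In particular, $R_\delta(\pm1)=\tfrac12\bar\kappa\,\varepsilon_\delta+O(\varepsilon_\delta^m)$.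
   Context: Fix $m\in(1,\infty)$ and $\Phi(r)=\frac{1}{m(m+1)}\big((1-r)^{-m}-mr-1\big)$ for $r<1$. For $V\in L^2(\mathbb R)$ let $(AV)(x)=\int_{x-1/2}^{x+1/2}V(y)\,dy$. A solitary wave is a triple $(V,R,\sigma)$ with $\sigma>0$ satisfying $R=AV$ and $\sigma V=A\Phi'(R)$ on $\mathbb R$ (equivalently, for $V\in L^2$, $R'(x)=V(x+\frac12)-V(x-\frac12)$ and $\sigma V'(x)=\Phi'(R(x+\frac12))-\Phi'(R(x-\frac12))$ for all $x\in\mathbb R$). A function is unimodal if it is increasing for negative $x$ and decreasing for positive $x$. A high-energy family is a family $(V_\delta,R_\delta,\sigma_\delta)_{0<\delta<1}$ of solitary waves such that (i) $V_\delta,R_\delta\in L^2(\mathbb R)\cap BC^1(\mathbb R)$ are nonnegative, even and unimodal; (ii) $\|V_\delta\|_2=1-\delta$ and $R_\delta$ takes values in $[0,1)$; (iii) $p_\delta:=\int_{\mathbb R}\Phi(R_\delta(x))\,dx\to+\infty$ as $\delta\to0$. Its parameters are $\varepsilon_\delta:=1-R_\delta(0)$ and $\mu_\delta:=\sqrt{\sigma_\delta\,\varepsilon_\delta^{m+2}}$. $\tilde S_0:\mathbb R\to\mathbb R$ is the solution of $\tilde S_0''=\frac{2}{m+1}\,(1+\tilde S_0)^{-(m+1)}$, $\tilde S_0(0)=\tilde S_0'(0)=0$; $\bar\mu:=\frac{2}{\sqrt{m(m+1)}}$ and $\bar\kappa:=\int_0^\infty\tilde x\,\tilde S_0''(\tilde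 x)\,d\tilde x$ (a convergent integral). $O(\varepsilon_\delta^k)$ denotes a quantity bounded in absolute value by $C\varepsilon_\delta^k$ with $C$ independent of $\delta$. *)

(* Defs.v *)
From HB Require Import structures.
From mathcomp Require Import all_boot all_order all_algebra.
From mathcomp Require Import all_classical all_reals all_analysis.
Import Order.TTheory GRing.Theory Num.Theory numFieldNormedType.Exports.

Set Implicit Arguments.
Unset Strict Implicit.
Unset Printing Implicit Defensive.

Local Open Scope classical_set_scope.
Local Open Scope ring_scope.

(* The potential; only its values for r < 1 are meaningful. *)
Definition Phi {K : realType} (m r : K) : K :=
  (m * (m + 1))^-1 * ((1 - r) `^ (- m) - m * r - 1).

Definition averaging {K : realType} (V : K -> K) (x : K) : K :=
  \int[lebesgue_measure]_(y in `[x - 2^-1, x + 2^-1]) V y.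

Definition square_integrable {K : realType} (f : K -> K) : Prop :=
  (f : measurableTypeR K -> K) \in Lfun lebesgue_measure 2%:E.

Definition norm2 {K : realType} (f : K -> K) : \bar K :=
  'N[lebesgue_measure]_2%:E[EFin \o f]%E.

(* The condition R < 1 is the domain condition for Phi. *)
Definition solitary_wave {K : realType} (m : K) (V R : K -> K) (sigma : K)
    : Prop :=
  [/\ square_integrable V, 0 < sigma,
      forall x, R x = averaging V x,
      forall x, R x < 1
    & forall x, sigma * V x = averaging (derive1 (Phi m) \o R) x].

(* Bounded C^1 functions with bounded derivative. *)
Definition BC1 {K : realType} (f : K -> K) : Prop :=
  [/\ forall x, derivable f x 1, continuous (derive1 f),
      bounded_fun f & bounded_fun (derive1 f)].

(* Monotonicity is non-strict. *)
Definition unimodal {K : realType} (f : K -> K) : Prop :=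
  {in `]-oo, 0[ &, {homo f : x y / x <= y}} /\
  {in `]0, +oo[ &, {homo f : x y /~ x <= y}}.

Definition wave_profile {K : realType} (f : K -> K) : Prop :=
  [/\ square_integrable f, BC1 f, forall x, 0 <= f x,
      forall x, f (- x) = f x & unimodal f].

Definition potential_energy {K : realType} (m : K) (R : K -> K) : K :=
  \int[lebesgue_measure]_x Phi m (R x).

(* A family indexed by delta in ]0, 1[; the values of V, R and sigma at other
   indices are irrelevant. *)
Definition high_energy_family {K : realType} (m : K)
    (V R : K -> K -> K) (sigma : K -> K) : Prop :=
  (forall d, 0 < d < 1 ->
     [/\ solitary_wave m (V d) (R d) (sigma d),
         wave_profile (V d), wave_profile (R d),
         norm2 (V d) = (1 - d)%:E
       & forall x, 0 <= R d x < 1]) /\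
  potential_energy m (R d) @[d --> 0^'+] --> +oo.

Definition eps {K : realType} (R : K -> K -> K) (d : K) : K := 1 - R d 0.

Definition mu {K : realType} (m : K) (R : K -> K -> K) (sigma : K -> K)
    (d : K) : K :=
  Num.sqrt (sigma d * eps R d `^ (m + 2)).

(* The condition -1 < S is the domain condition for the right-hand side. *)
Definition limit_ODE {K : realType} (m : K) (S : K -> K) : Prop :=
  [/\ forall x, -1 < S x,
      forall x, derivable S x 1,
      forall x, derivable (derive1 S) x 1,
      forall x, derive1n 2 S x = 2 / (m + 1) * (1 + S x) `^ (- (m + 1))
    & S 0 = 0 /\ derive1 S 0 = 0].

Definition mu_bar {K : realType} (m : K) : K := 2 / Num.sqrt (m * (m + 1)).

Definition kappa_bar {K : realType} (S : K -> K) : K :=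
  \int[lebesgue_measure]_(x in `[0, +oo[) (x * derive1n 2 S x).

Definition T_resc {K : realType} (m : K) (R : K -> K -> K) (sigma : K -> K)
    (d : K) (x : K) : K :=
  R d (-1 + mu m R sigma d * x) / eps R d.

Definition T_lim {K : realType} (m : K) (S : K -> K) (x : K) : K :=
  2^-1 * (S x + mu_bar m * x + kappa_bar S).

Definition J {K : realType} (m : K) (R : K -> K -> K) (sigma : K -> K)
    (d : K) : set K :=
  `[- (2 * mu m R sigma d)^-1, (2 * mu m R sigma d)^-1].

(* Main.v *)
(* Near the tip, S(x) = (1 - R(mu x)) / eps - 1 satisfies the limit equation up
   to an error O(eps^(m+1)), because the other two terms of the advance-delay
   equation sigma R'' = P(R(x+1)) - 2 P(R(x)) + P(R(x-1)), with P = Phi', are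
   evaluated where R <= R(1/2) <= 3/4.  Both S and S0 grow at least linearly, so
   the linearized force decays like (1+x)^-(m+2), and a weighted Gronwall
   estimate gives |S - S0| = O(eps^(m+1) (1+x)^2), hence forces that differ by
   O(eps^(m+1)) uniformly on the interval J of length O(1/eps).  Near -1 the
   term P(R(x+1)) is half the tip force, which yields the bound on T'' - T0''.
   The bounds on T' - T0' and T - T0 follow by integration from the left end of
   J, where T and T' are controlled by V(1) and where T0 and T0' are small by
   conservation of energy and the definition of kappa_bar. *)
Require Import Defs.
From HB Require Import structures.
From mathcomp Require Import all_boot all_order all_algebra.
From mathcomp Require Import all_classical all_reals all_analysis measurable_realfun.
From mathcomp Require Import ring lra.
Import Order.TTheory GRing.Theory Num.Theory numFieldNormedType.Exports.
Local Open Scope classical_set_scope.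
Local Open Scope ring_scope.

Set Implicit Arguments.
Unset Strict Implicit.
Unset Printing Implicit Defensive.

(** The interval J has length of order 1/eps, so an ordinary Gronwall factor would be exponential in
    1/eps. Bounding |S - S0| at x by x times a monotone bound for its derivative turns the
    coefficient (1+x)^-(m+2) into (1+x)^-(m+1), whose integral over the half-line is 1/m; the factor
    is then exp(A/m), whatever the length of the interval. This needs the linear growth of S before
    S is compared with S0, and energy provides it. The neglected terms only lower the force, so S'
    <= mu_bar and S <= mu_bar on [0, 1], which keeps the force away from 0 there; afterwards S'' >=
    0 preserves the slope gained. The weights eps^2, eps, 1 are the price of integration: each
    integration across J costs a factor of order 1/eps. The bounds on a single wave are the same for
    every delta, so one constant serves all of them, not only the small ones. *)

(** * Comparison of increments, differentiation rules and real powers *)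

Lemma is_derive_continuous (K : realType) (f : K -> K) (x df : K) :
  is_derive x 1 f df -> {for x, continuous f}.
Proof.
by case=> d _; apply: differentiable_continuous; apply/derivable1_diffP.
Qed.

Lemma is_derive_eqP (K : realType) (f : K -> K) (x a b : K) :
  is_derive x 1 f a -> a = b -> is_derive x 1 f b.
Proof. by move=> h <-. Qed.

Lemma increment_le (K : realType) (F f G g : K -> K) (a b : K) : a <= b ->
  (forall x, a <= x <= b -> is_derive x 1 F (f x)) ->
  (forall x, a <= x <= b -> is_derive x 1 G (g x)) ->
  (forall x, a < x < b -> f x <= g x) ->
  F b - F a <= G b - G a.
Proof.
move=> ab dF dG fg.
have dH x : a <= x <= b -> is_derive x 1 (G \- F) (g x - f x).
  by move=> xab; have ? := dF _ xab; have ? := dG _ xab; exact: is_deriveB.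
move: (ab); rewrite le_eqVlt => /predU1P[->|altb]; first by rewrite !subrr.
have [||c cab] := @MVT K (G \- F) (g \- f) a b altb.
- by move=> x; rewrite in_itv/= => /andP[/ltW ? /ltW ?]; apply: dH; apply/andP.
- apply/continuous_in_subspaceT => x; rewrite inE/= in_itv/= => /dH.
  exact: is_derive_continuous.
move=> /= e; rewrite -subr_ge0.
have -> : G b - G a - (F b - F a) = G b - F b - (G a - F a) by ring.
by rewrite e mulr_ge0 ?subr_ge0 // fg// -in_itv.
Qed.

Lemma increment_ge_cst (K : realType) (F f : K -> K) (a b c : K) : a <= b ->
  (forall x, a <= x <= b -> is_derive x 1 F (f x)) ->
  (forall x, a < x < b -> c <= f x) -> c * (b - a) <= F b - F a.
Proof.
move=> ab dF cf; rewrite mulrBr.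
apply: (@increment_le _ (fun x => c * x) (cst c) F f) => // x xab.
by apply: is_derive_eqP; rewrite /GRing.scale/=; ring.
Qed.

Lemma increment_le_cst (K : realType) (F f : K -> K) (a b c : K) : a <= b ->
  (forall x, a <= x <= b -> is_derive x 1 F (f x)) ->
  (forall x, a < x < b -> f x <= c) -> F b - F a <= c * (b - a).
Proof.
move=> ab dF cf; rewrite mulrBr.
apply: (@increment_le _ F f (fun x => c * x) (cst c)) => // x xab.
by apply: is_derive_eqP; rewrite /GRing.scale/=; ring.
Qed.

Lemma increment_norm_le (K : realType) (F f G g : K -> K) (a b : K) : a <= b ->
  (forall x, a <= x <= b -> is_derive x 1 F (f x)) ->
  (forall x, a <= x <= b -> is_derive x 1 G (g x)) ->
  (forall x, a < x < b -> `|f x| <= g x) ->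
  `|F b - F a| <= G b - G a.
Proof.
move=> ab dF dG fg; rewrite ler_norml; apply/andP; split; last first.
  by apply: increment_le dF dG _ => // x /fg; rewrite ler_norml => /andP[].
have dNF x : a <= x <= b -> is_derive x 1 (\- F) (- f x).
  by move=> xab; have ? := dF _ xab; exact: is_deriveN.
have : - F b - - F a <= G b - G a.
  by apply: increment_le dNF dG _ => // x /fg; rewrite ler_norml lerNl => /andP[].
by lra.
Qed.

Lemma increment_norm_le_cst (K : realType) (F f : K -> K) (a b c : K) : a <= b ->
  (forall x, a <= x <= b -> is_derive x 1 F (f x)) ->
  (forall x, a < x < b -> `|f x| <= c) -> `|F b - F a| <= c * (b - a).
Proof.
move=> ab dF cf; rewrite mulrBr.
apply: (@increment_norm_le _ F f (fun x => c * x) (cst c)) => // x xab.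
by apply: is_derive_eqP; rewrite /GRing.scale/=; ring.
Qed.

Lemma is_derive1_comp_add (K : realType) (f : K -> K) (a x df : K) :
  is_derive (x + a) 1 f df -> is_derive x 1 (fun y => f (y + a)) df.
Proof.
move=> h.
have h1 : is_derive x 1 (fun y => y + a) 1 by apply: is_derive_eqP; rewrite addr0.
by have := @is_derive1_comp _ f (fun y => y + a) x df 1 h h1; rewrite mulr1.
Qed.

Lemma is_derive1_comp_affine (K : realType) (f : K -> K) (a b x df : K) :
  is_derive (a + b * x) 1 f df -> is_derive x 1 (fun y => f (a + b * y)) (df * b).
Proof.
move=> h.
have h1 : is_derive x 1 (fun y => a + b * y) b.
  by apply: is_derive_eqP; rewrite /GRing.scale/=; ring.
exact: (@is_derive1_comp _ f (fun y => a + b * y) x df b h h1).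
Qed.

Lemma is_derive1_powR_comp (K : realType) (f : K -> K) (p x df : K) : 0 < f x ->
  is_derive x 1 f df ->
  is_derive x 1 (fun y => f y `^ p) (p * f x `^ (p - 1) * df).
Proof.
move=> fx h.
exact: (@is_derive1_comp _ (fun y => y `^ p) f x _ _ (is_derive1_powR p fx) h).
Qed.

Lemma is_derive1_powR_onep (K : realType) (p x : K) : 0 < 1 + x ->
  is_derive x 1 (fun y => (1 + y) `^ p) (p * (1 + x) `^ (p - 1)).
Proof.
move=> x0.
have h1 : is_derive x 1 (fun y => 1 + y) 1 by apply: is_derive_eqP; rewrite /GRing.scale/=; ring.
exact: (is_derive_eqP (@is_derive1_powR_comp _ (fun y => 1 + y) p x 1 x0 h1) (mulr1 _)).
Qed.

Lemma le_powRN (K : realType) (p x y : K) : 0 <= p -> 0 < x -> x <= y ->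
  y `^ (- p) <= x `^ (- p).
Proof.
move=> p0 x0 xy; rewrite !powRN lef_pV2 ?posrE ?powR_gt0 ?(lt_le_trans x0)//.
by apply: ge0_ler_powR => //; rewrite nnegrE ltW // (lt_le_trans x0).
Qed.

Lemma powRN_le1 (K : realType) (p x : K) : 0 <= p -> 1 <= x -> x `^ (- p) <= 1.
Proof.
by move=> p0 x1; have := le_powRN p0 ltr01 x1; rewrite powR1.
Qed.

Lemma powRD1 (K : realType) (x p : K) : 0 < x -> x `^ (p + 1) = x `^ p * x.
Proof.
move=> x0; rewrite powRD ?powRr1 ?(ltW x0)//.
by rewrite (gt_eqF x0) implybT.
Qed.

(** * A Gronwall estimate with an integrable weight *)

Lemma gronwall_powR (K : realType) (m A eta X : K) (D D1 D2 : K -> K) :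
  0 < m -> 0 <= A -> 0 < eta -> 0 <= X ->
  (forall x : K, 0 <= x <= X -> is_derive x 1 D (D1 x)) ->
  (forall x : K, 0 <= x <= X -> is_derive x 1 D1 (D2 x)) ->
  D 0 = 0 -> D1 0 = 0 ->
  (forall x : K, 0 <= x <= X ->
     `|D2 x| <= A * (1 + x) `^ (- (m + 2)) * `|D x| + eta) ->
  forall x : K, 0 <= x <= X -> `|D1 x| <= eta * (1 + x) * expR (A / m).
Proof.
move=> m0 A0 eta0 X0 dD dD1 D0 D10 D2le.
(* The weight v is a supersolution of the linearized equation; the maximum of
   |D1| / v cannot exceed 1. *)
pose E x : K := expR (A / m * (1 - (1 + x) `^ (- m))).
pose w x : K := A * (1 + x) `^ (- (m + 1)).
(* The exponent of [E] is the integral of [w] over [0, x]; it stays below [A / m], hence the factor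
   [expR (A / m)] in the conclusion. *)
have dE (x : K) : 0 <= x -> is_derive x 1 E (E x * w x).
  move=> x0; have x1 : 0 < 1 + x by lra.
  have dp := is_derive1_powR_onep (- m) x1.
  have dl : is_derive x 1 (fun y => A / m * (1 - (1 + y) `^ (- m))) (w x).
    apply: is_derive_eqP; rewrite /GRing.scale/= /w opprD; field; lra.
  exact: (@is_derive1_comp _ expR (fun y => A / m * (1 - (1 + y) `^ (- m))) x _ _
    (is_derive_expR _) dl).
pose v x : K := eta * (1 + x) * E x.
have dv (x : K) : 0 <= x -> is_derive x 1 v (eta * E x + v x * w x).
  move=> x0; have ? := dE _ x0.
  by apply: is_derive_eqP; rewrite /GRing.scale/= /v; ring.
have E1 (x : K) : 0 <= x -> 1 <= E x.
  move=> x0; rewrite -expR0 ler_expR mulr_ge0 ?divr_ge0 ?(ltW m0)//.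
  by rewrite subr_ge0 powRN_le1 ?(ltW m0)//; lra.
have EM (x : K) : 0 <= x -> E x <= expR (A / m).
  move=> x0; rewrite ler_expR ler_piMr ?divr_ge0 ?(ltW m0)//.
  by rewrite lerBlDr lerDl powR_ge0.
have v0 (x : K) : 0 <= x -> 0 < v x.
  by move=> x0; rewrite /v !mulr_gt0 ?expR_gt0//; lra.
have w0 x : 0 <= w x by rewrite mulr_ge0 ?powR_ge0.
have vmono x y : 0 <= x -> x <= y -> v x <= v y.
  move=> x0 xy; rewrite -subr_ge0 -[leLHS](mul0r (y - x)).
  apply: (@increment_ge_cst _ v (fun x => eta * E x + v x * w x)); first exact: xy.
  - by move=> z /andP[zx _]; apply: dv; lra.
  - move=> z /andP[zx _]; have z0 : 0 <= z by lra.
    apply: addr_ge0; first exact: mulr_ge0 (ltW eta0) (le_trans ler01 (E1 _ z0)).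
    exact: mulr_ge0 (ltW (v0 _ z0)) (w0 z).
have [c cX cmax] : exists2 c, c \in `[0, X] &
    forall t, t \in `[0, X] -> `|D1 t| / v t <= `|D1 c| / v c.
  apply: (@EVT_max _ (fun t => `|D1 t| / v t)) => //.
  apply/continuous_in_subspaceT => x; rewrite inE/= in_itv/= => xX.
  have x0 : 0 <= x by lra.
  have c1 : {for x, continuous (fun t => `|D1 t|)}.
    by apply: cvg_norm; exact: is_derive_continuous (dD1 _ xX).
  have c2 : {for x, continuous (fun t => (v t)^-1)}.
    apply: continuousV; first by rewrite gt_eqF ?v0.
    exact: is_derive_continuous (dv _ x0).
  exact: continuousM c1 c2.
rewrite in_itv/= in cX; have c0 : 0 <= c by lra.
set M := `|D1 c| / v c in cmax.
have M0 : 0 <= M by rewrite divr_ge0 // ltW // v0.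
have D1M t : 0 <= t <= X -> `|D1 t| <= M * v t.
  by move=> tX; rewrite -ler_pdivrMr ?cmax ?in_itv// v0//; lra.
have DM t : 0 <= t <= X -> `|D t| <= M * v t * t.
  move=> tX; have := @increment_norm_le_cst _ D D1 0 t (M * v t).
  rewrite D0 !subr0; apply.
  - by lra.
  - by move=> x xt; apply: dD; lra.
  - move=> x xt; apply: le_trans (D1M x _) _; first lra.
    by rewrite ler_wpM2l ?M0 ?vmono//; lra.
(* If M > 1, then |D2| <= M v' on [0, c]; integrating from 0, where [D1] vanishes, gives |D1 c| <= M
   v(c) - M v(0) < M v(c), against the choice of [c]. *)
have M1 : M <= 1.
  rewrite leNgt; apply/negP => M1.
  have : `|D1 c - D1 0| <= M * v c - M * v 0.
    apply: (@increment_norm_le _ D1 D2 (fun x => M * v x)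
      (fun x => M * (eta * E x + v x * w x))); first by lra.
    - by move=> x xc; apply: dD1; lra.
    - move=> x xc; have x0 : 0 <= x by lra.
      have ? := dv _ x0.
      by apply: is_derive_eqP; rewrite /GRing.scale/=; ring.
    - move=> x xc; have xX : 0 <= x <= X by lra.
      have x0 : 0 <= x by lra.
      apply: le_trans (D2le _ xX) _.
      rewrite mulrDr addrC lerD//.
        rewrite mulrCA ler_peMr ?(ltW eta0)//.
        by rewrite -[leLHS](mulr1 1) ler_pM ?E1 ?(ltW M1).
      rewrite -mulrA.
      have -> : M * (v x * w x) = A * ((1 + x) `^ (- (m + 1)) * (M * v x)).
        by rewrite /w; ring.
      rewrite ler_wpM2l//.
      (* One factor 1 + x of the weight pays for the factor x in the bound [DM] on |D|; what remains
         is the integrable weight [w]. *)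
      have -> : - (m + 1) = - (m + 2) + 1 by ring.
      rewrite powRD1; last by lra.
      rewrite -mulrA ler_wpM2l ?powR_ge0//.
      apply: le_trans (DM _ xX) _; rewrite mulrC ler_wpM2r//; last by lra.
      by rewrite mulr_ge0// ltW // v0.
  rewrite D10 subr0.
  have -> : `|D1 c| = M * v c by rewrite /M divfK// gt_eqF ?v0.
  have : 0 < M * v 0 by rewrite mulr_gt0 ?v0//; lra.
  by lra.
move=> x xX; have x0 : 0 <= x by lra.
apply: le_trans (D1M _ xX) _; apply: le_trans (ler_piMl (ltW (v0 _ x0)) M1) _.
by rewrite /v ler_wpM2l ?EM// mulr_ge0 ?(ltW eta0)//; lra.
Qed.

(** * Approximate solutions of the limit equation *)

(** The right-hand side of the limit equation. Up to an additive constant it is also the central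
    term 2 Phi'(R) of the wave equation after rescaling, see [tip_force_rescaled]. *)
Definition tip_force (K : realType) (m s : K) : K :=
  2 / (m + 1) * (1 + s) `^ (- (m + 1)).

Lemma tip_force_ge0 (K : realType) (m s : K) : 0 < m -> 0 <= tip_force m s.
Proof. by move=> m0; rewrite mulr_ge0 ?powR_ge0// divr_ge0; lra. Qed.

Lemma tip_force_le (K : realType) (m s t : K) : 0 < m -> -1 < s -> s <= t ->
  tip_force m t <= tip_force m s.
Proof.
move=> m0 s1 st; rewrite ler_wpM2l ?divr_ge0 ?le_powRN//; lra.
Qed.

Lemma tip_force_lipschitz (K : realType) (m y s t : K) : 0 < m -> 0 < y ->
  y <= 1 + s -> y <= 1 + t ->
  `|tip_force m s - tip_force m t| <= 2 * y `^ (- (m + 2)) * `|s - t|.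
Proof.
move=> m0 y0; wlog st : s t / t <= s.
  move=> H ys yt; case: (leP t s) => [/H|/ltW /H]; first exact.
  by rewrite (distrC s) (distrC (tip_force m s)); apply.
move=> ys yt; rewrite (ger0_norm (_ : 0 <= s - t)) ?subr_ge0//.
apply: (@increment_norm_le_cst _ (tip_force m)
  (fun x => - 2 * (1 + x) `^ (- (m + 2)))) => // x xts.
- have x1 : 0 < 1 + x by lra.
  have ? := is_derive1_powR_onep (- (m + 1)) x1.
  have -> : - (m + 2) = - (m + 1) - 1 by ring.
  by apply: is_derive_eqP; rewrite /GRing.scale/=; field; lra.
- rewrite normrM normrN !ger0_norm ?powR_ge0// ler_wpM2l//.
  by rewrite le_powRN//; lra.
Qed.

(** One notion for the rescaled wave ([eta] > 0), for the limit profile and for its reflection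
    ([eta] = 0). The defect is one-sided, so that energy can only decrease. [0 <= S2] is a separate
    clause because the force minus [eta] may become negative far out. *)
Definition tip_profile (K : realType) (m eta X : K) (S S1 S2 : K -> K) : Prop :=
  [/\ S 0 = 0, S1 0 = 0,
      forall x, 0 <= x <= X -> is_derive x 1 S (S1 x),
      forall x, 0 <= x <= X -> is_derive x 1 S1 (S2 x)
    & forall x, 0 <= x <= X ->
        0 <= S2 x /\ tip_force m (S x) - eta <= S2 x <= tip_force m (S x)].

Lemma tip_profile_ge0 (K : realType) (m eta X : K) (S S1 S2 : K -> K) :
  tip_profile m eta X S S1 S2 ->
  forall x, 0 <= x <= X -> 0 <= S1 x /\ 0 <= S x.
Proof.
case=> S0 S10 dS dS1 S2b.
have S1ge x : 0 <= x <= X -> 0 <= S1 x.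
  move=> xX; have := @increment_ge_cst _ S1 S2 0 x 0; rewrite S10 mul0r subr0.
  apply=> [|y xy|y xy]; [lra|by apply: dS1; lra|].
  by apply: (S2b y _).1; lra.
move=> x xX; split; first exact: S1ge.
have := @increment_ge_cst _ S S1 0 x 0; rewrite S0 mul0r subr0.
apply=> [|y xy|y xy]; [lra|by apply: dS; lra|by apply: S1ge; lra].
Qed.

Lemma mu_bar_gt0 (K : realType) (m : K) : 0 < m -> 0 < mu_bar m.
Proof. by move=> m0; rewrite divr_gt0// sqrtr_gt0 mulr_gt0//; lra. Qed.

Lemma sqr_mu_bar (K : realType) (m : K) : 0 < m ->
  mu_bar m ^+ 2 = 4 / (m * (m + 1)).
Proof.
by move=> m0; rewrite /mu_bar expr_div_n sqr_sqrtr ?mulr_ge0 -?natrX//; lra.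
Qed.

(** The first integral obtained by multiplying the limit equation by 2 S'. The value mu_bar^2 = 4 /
    (m (m+1)) is the one for which the two terms balance. *)
Lemma is_derive_energy (K : realType) (m x s1 s2 : K) (S S1 : K -> K) :
  0 < m -> 0 <= S x -> is_derive x 1 S s1 -> is_derive x 1 S1 s2 -> S1 x = s1 ->
  is_derive x 1 (fun y => S1 y ^+ 2 + mu_bar m ^+ 2 * (1 + S y) `^ (- m))
    (2 * S1 x * (s2 - tip_force m (S x))).
Proof.
move=> m0 Sx dS dS1 e.
have d1 : is_derive x 1 (fun y => 1 + S y) s1.
  by apply: is_derive_eqP; rewrite /GRing.scale/=; ring.
have p1 : 0 < 1 + S x by lra.
have dp := @is_derive1_powR_comp _ (fun y => 1 + S y) (- m) x s1 p1 d1.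
rewrite sqr_mu_bar//.
have dS12 : is_derive x 1 (fun y => S1 y ^+ 2) (2 * S1 x * s2).
  by apply: is_derive_eqP; rewrite /GRing.scale/=; ring.
apply: is_derive_eqP; rewrite /tip_force /GRing.scale/= e opprD.
by field; lra.
Qed.

(** As S1 >= 0 and S2 is at most the force, the energy does not increase, and it starts from
    mu_bar^2. *)
Lemma tip_profile_energy (K : realType) (m eta X : K) (S S1 S2 : K -> K) :
  0 < m -> tip_profile m eta X S S1 S2 ->
  forall x, 0 <= x <= X -> S1 x ^+ 2 <= mu_bar m ^+ 2 * (1 - (1 + S x) `^ (- m)).
Proof.
move=> m0 H; have pos := tip_profile_ge0 H; case: H => S0 S10 dS dS1 S2b x xX.
have := @increment_le_cst _ (fun y => S1 y ^+ 2 + mu_bar m ^+ 2 * (1 + S y) `^ (- m))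
  (fun x => 2 * S1 x * (S2 x - tip_force m (S x))) 0 x 0.
rewrite S0 S10 addr0 powR1 mul0r => h.
have {h} : S1 x ^+ 2 + mu_bar m ^+ 2 * (1 + S x) `^ (- m)
    - (0 ^+ 2 + mu_bar m ^+ 2 * 1) <= 0.
  apply: h => [|y xy|y xy]; first by lra.
    apply: is_derive_energy => //; [apply: (pos y _).2; lra| |by apply: dS1; lra].
    by apply: dS; lra.
  rewrite mulr_ge0_le0 ?mulr_ge0//; first by apply: (pos y _).1; lra.
  have yX : 0 <= y <= X by lra. have [_ ?] := S2b _ yX; lra.
by lra.
Qed.

Lemma tip_profile_slope (K : realType) (m eta X : K) (S S1 S2 : K -> K) :
  0 < m -> tip_profile m eta X S S1 S2 ->
  forall x, 0 <= x <= X -> S1 x <= mu_bar m /\ S x <= mu_bar m * x.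
Proof.
move=> m0 H; have pos := tip_profile_ge0 H.
have S1le x : 0 <= x <= X -> S1 x <= mu_bar m.
  move=> xX; have := tip_profile_energy m0 H xX.
  have : 0 <= mu_bar m ^+ 2 * (1 + S x) `^ (- m) by rewrite mulr_ge0 ?sqr_ge0 ?powR_ge0.
  move=> h h'; have : S1 x ^+ 2 <= mu_bar m ^+ 2 by lra.
  by rewrite ler_sqr// nnegrE ?(pos x xX).1// ltW// mu_bar_gt0.
case: H => S0 S10 dS dS1 S2b x xX; split; first exact: S1le.
have := @increment_le_cst _ S S1 0 x (mu_bar m); rewrite S0 !subr0.
by apply=> [|y xy|y xy]; [lra|apply: dS; lra|apply: S1le; lra].
Qed.

(* S'' is at least tip_force m (mu_bar m) - eta on [0, 1] because S <= mu_bar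
   there; the factor 2 leaves room for eta. *)
Definition growth_rate (K : realType) (m : K) : K := tip_force m (mu_bar m) / 2.

Lemma growth_rate_gt0 (K : realType) (m : K) : 0 < m -> 0 < growth_rate m.
Proof.
move=> m0; have mb := mu_bar_gt0 m0.
rewrite divr_gt0// mulr_gt0 ?powR_gt0// ?divr_gt0//; lra.
Qed.

Lemma growth_rate_le (K : realType) (m : K) : 1 < m -> growth_rate m <= 1 / 2.
Proof.
move=> m1; have m0 : 0 < m by lra.
have mb := mu_bar_gt0 m0.
have le1 : (1 + mu_bar m) `^ (- (m + 1)) <= 1 by apply: powRN_le1; lra.
have h : 2 / (m + 1) <= 1 by rewrite ler_pdivrMr; lra.
have : 2 / (m + 1) * (1 + mu_bar m) `^ (- (m + 1)) <= 1 * 1.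
  by rewrite ler_pM ?powR_ge0 ?divr_ge0//; lra.
by rewrite /growth_rate /tip_force; lra.
Qed.

(** With c the growth rate, the force is at least 2 c on [0, 1], so S'' >= c there and S'(1) >= c;
    since S'' >= 0, the slope stays at least c beyond 1. The bound c <= 1/2 covers [0, 1] and the
    shift from x - 1 to x + 1. *)
Lemma tip_profile_growth (K : realType) (m eta X : K) (S S1 S2 : K -> K) :
  1 < m -> eta <= growth_rate m -> tip_profile m eta X S S1 S2 ->
  forall x, 0 <= x <= X -> growth_rate m * (1 + x) <= 1 + S x.
Proof.
move=> m1 etale H; have m0 : 0 < m by lra.
have pos := tip_profile_ge0 H; have slope := tip_profile_slope m0 H.
have mb := mu_bar_gt0 m0; have c0 := growth_rate_gt0 m0; have c1 := growth_rate_le m1.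
set c := growth_rate m in etale c0 c1 *.
case: H => S0 S10 dS dS1 S2b x xX.
have S1ge y : 0 <= y -> y <= X -> y <= 1 -> c * y <= S1 y.
  move=> y0 yX y1.
  have := @increment_ge_cst _ S1 S2 0 y c; rewrite S10 !subr0.
  apply=> [|z zy|z zy]; [lra|apply: dS1; lra|].
  have zX : 0 <= z <= X by lra.
  have [_ /andP[+ _]] := S2b _ zX.
  have Sz := (pos _ zX).2.
  have : tip_force m (mu_bar m) <= tip_force m (S z).
    apply: tip_force_le => //; first by lra.
    apply: le_trans (slope _ zX).2 _; rewrite ler_piMr//; lra.
  have -> : tip_force m (mu_bar m) = 2 * c by rewrite /c /growth_rate; field.
  by lra.
have S1ge' y : 1 <= y -> y <= X -> c <= S1 y.
  move=> y1 yX.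
  have := @increment_ge_cst _ S1 S2 1 y 0; rewrite mul0r => h.
  have : 0 <= S1 y - S1 1.
    apply: h => [|z zy|z zy]; [lra|apply: dS1; lra|].
    by apply: (S2b z _).1; lra.
  have : c * 1 <= S1 1 by apply: S1ge; lra.
  by lra.
have [x1|x1] := leP x 1.
  have := (pos _ xX).2.
  have : c * (1 + x) <= 1 / 2 * 2 by rewrite ler_pM//; lra.
  by lra.
have : c * (x - 1) <= S x - S 1.
  apply: (@increment_ge_cst _ S S1) => [|z zy|z zy]; [lra|apply: dS; lra|].
  by apply: S1ge'; lra.
have : 0 <= S 1 by apply: (pos 1 _).2; lra.
by lra.
Qed.

(** Where 1 + S >= c (1+x), the Lipschitz constant of the force is 2 (c (1+x))^-(m+2); this is its
    factor in front of (1+x)^-(m+2). *)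
Definition comparison_rate (K : realType) (m c : K) : K := 2 * c `^ (- (m + 2)).

(** The Gronwall bound on S' - T' integrates to a quadratic bound on S - T, and the Lipschitz weight
    (1+x)^-(m+2) absorbs this growth. So the forces stay O(eta) apart on an interval of any
    length. *)
Lemma tip_profile_compare (K : realType) (m eta X c : K)
    (S S1 S2 T T1 T2 : K -> K) :
  let C := expR (comparison_rate m c / m) in
  0 < m -> 0 < eta -> 0 < c ->
  tip_profile m eta X S S1 S2 -> tip_profile m 0 X T T1 T2 ->
  (forall x, 0 <= x <= X -> c * (1 + x) <= 1 + S x) ->
  (forall x, 0 <= x <= X -> c * (1 + x) <= 1 + T x) ->
  forall x, 0 <= x <= X ->
    `|S x - T x| <= eta * C * (1 + x) ^+ 2 /\
    `|tip_force m (S x) - tip_force m (T x)| <= comparison_rate m c * C * eta.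
Proof.
move=> C m0 eta0 c0 [S0 S10 dS dS1 S2b] [T0 T10 dT dT1 T2b] Sc Tc.
set A := comparison_rate m c.
have A0 : 0 <= A by rewrite mulr_ge0 ?powR_ge0.
have lip x : 0 <= x <= X ->
    `|tip_force m (S x) - tip_force m (T x)| <= A * (1 + x) `^ (- (m + 2)) * `|S x - T x|.
  move=> xX; rewrite /A /comparison_rate -[2 * _ * _ in leRHS]mulrA.
  rewrite -powRM ?(ltW c0)//; last by lra.
  by apply: tip_force_lipschitz; rewrite ?Sc ?Tc// mulr_gt0//; lra.
have D1le x : 0 <= x <= X -> `|S1 x - T1 x| <= eta * (1 + x) * C.
  move=> xX; have X0 : 0 <= X by lra.
  apply: (@gronwall_powR _ m A eta X (fun x => S x - T x) (fun x => S1 x - T1 x)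
    (fun x => S2 x - T2 x)) => // [y yX|y yX|||y yX].
  - by have ? := dS _ yX; have ? := dT _ yX; exact: is_deriveB.
  - by have ? := dS1 _ yX; have ? := dT1 _ yX; exact: is_deriveB.
  - by rewrite S0 T0 subrr.
  - by rewrite S10 T10 subrr.
  - have [_ h1] := S2b _ yX; have [_ h2] := T2b _ yX.
    have := lip _ yX; rewrite !ler_norml => h3.
    by lra.
have Dle x : 0 <= x <= X -> `|S x - T x| <= eta * C * (1 + x) ^+ 2.
  move=> xX.
  have C0 : 0 < C by exact: expR_gt0.
  have := @increment_norm_le_cst _ (fun x => S x - T x) (fun x => S1 x - T1 x) 0 x
    (eta * (1 + x) * C).
  rewrite S0 T0 !subr0 => h.
  apply: le_trans (h _ _ _) _.
  - by lra.
  - move=> y yx; have yX : 0 <= y <= X by lra.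
    by have ? := dS _ yX; have ? := dT _ yX; exact: is_deriveB.
  - move=> y yx; apply: le_trans (D1le y _) _; first by lra.
    by rewrite ler_wpM2r ?(ltW C0)// ler_wpM2l ?(ltW eta0)//; lra.
  - have -> : eta * C * (1 + x) ^+ 2 = eta * (1 + x) * C * (1 + x) by ring.
    by rewrite ler_wpM2l ?mulr_ge0 ?(ltW C0) ?(ltW eta0)//; lra.
move=> x xX; split; first exact: Dle.
have x1 : 0 < 1 + x by lra.
apply: le_trans (lip _ xX) _.
have -> : A * C * eta = A * (eta * C) by ring.
rewrite -mulrA ler_wpM2l//.
apply: le_trans (ler_wpM2l (powR_ge0 _ _) (Dle _ xX)) _.
rewrite mulrCA ler_piMr ?mulr_ge0 ?expR_ge0 ?(ltW eta0)//.
rewrite expr2 mulrA -!powRD1//.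
have -> : - (m + 2) + 1 + 1 = - m by ring.
by apply: powRN_le1; lra.
Qed.

(** * The limit profile: parity, asymptotic slope and [kappa_bar] *)

Lemma limit_ODE_is_derive (K : realType) (m : K) (S : K -> K) : limit_ODE m S ->
  [/\ forall x : K, is_derive x 1 S (derive1 S x),
      forall x : K, is_derive x 1 (derive1 S) (tip_force m (S x)),
      S 0 = 0 & derive1 S 0 = 0].
Proof.
case=> _ dS dS1 ode [S0 S10]; split=> // x.
  by apply: DeriveDef => //; rewrite derive1E.
by apply: DeriveDef => //; rewrite -derive1E /tip_force -ode.
Qed.

Lemma limit_ODE_tip_profile (K : realType) (m X : K) (S : K -> K) :
  0 < m -> limit_ODE m S ->
  tip_profile m 0 X S (derive1 S) (fun x => tip_force m (S x)).
Proof.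
move=> m0 /limit_ODE_is_derive[dS dS1 S0 S10]; split=> // x _.
by rewrite subr0 lexx tip_force_ge0.
Qed.

Lemma limit_ODE_tip_profileN (K : realType) (m X : K) (S : K -> K) :
  0 < m -> limit_ODE m S ->
  tip_profile m 0 X (fun x => S (- x)) (fun x => - derive1 S (- x))
    (fun x => tip_force m (S (- x))).
Proof.
move=> m0 /limit_ODE_is_derive[dS dS1 S0 S10].
have dN (f df : K -> K) (x : K) : (forall x : K, is_derive x 1 f (df x)) ->
    is_derive x 1 (fun y => f (- y)) (- df (- x)).
  move=> d; have h : is_derive (0 + -1 * x) 1 f (df (- x)).
    by rewrite add0r mulN1r.
  have := is_derive1_comp_affine h; rewrite mulrN1.
  by under [X in is_derive _ _ X _]eq_fun do rewrite add0r mulN1r.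
split=> [||x _|x _|x _]; rewrite ?oppr0 ?S10 ?oppr0//.
- exact: dN.
- have h := dN _ _ x dS1.
  by apply: is_derive_eqP; rewrite opprK.
- by rewrite addr0 lexx tip_force_ge0.
Qed.

Lemma le0_of_le_eps (K : realType) (a C : K) :
  (forall e, 0 < e -> a <= e * C) -> a <= 0.
Proof.
move=> h; rewrite leNgt; apply/negP => a0.
have C0 : 0 < C by have := h _ ltr01; lra.
have := h (a / (2 * C)); rewrite divr_gt0 ?mulr_gt0// => /(_ isT).
have -> : a / (2 * C) * C = a / 2 by field; rewrite gt_eqF.
by lra.
Qed.

(** Uniqueness for the initial value problem: S and its reflection are tip profiles with defect 0,
    hence with any defect e > 0, and the comparison bound is proportional to e. *)
Lemma limit_ODE_even (K : realType) (m : K) (S : K -> K) : 1 < m ->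
  limit_ODE m S -> forall x, S (- x) = S x.
Proof.
move=> m1 H; have m0 : 0 < m by lra.
suff h x : 0 <= x -> S (- x) = S x.
  by move=> x; case: (leP 0 x) => [/h//|x0]; have := h (- x); rewrite opprK => ->//; lra.
move=> x0; apply/eqP; rewrite -subr_eq0 -normr_le0.
have xx : 0 <= x <= x by rewrite x0 lexx.
have HP := limit_ODE_tip_profile x m0 H; have HN := limit_ODE_tip_profileN x m0 H.
have g0 := growth_rate_gt0 m0.
apply: (@le0_of_le_eps _ _ (expR (comparison_rate m (growth_rate m) / m) * (1 + x) ^+ 2)).
move=> e e0; rewrite mulrA.
have [|||h _] := @tip_profile_compare _ m e x (growth_rate m)
  (fun x => S (- x)) (fun x => - derive1 S (- x))
    (fun x => tip_force m (S (- x))) _ _ _ m0 e0 g0 _ HP _ _ x xx.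
- case: HN => ? ? ? ? b; split=> // y /b; lra.
- by move=> y yx; apply: (tip_profile_growth m1 (ltW g0) HN).
- by move=> y yx; apply: (tip_profile_growth m1 (ltW g0) HP).
- exact: h.
Qed.

(** Here the energy is conserved, so (mu_bar - S')(mu_bar + S') = mu_bar^2 (1+S)^-m. Dividing by
    mu_bar + S' >= mu_bar and inserting linear growth gives the decay. *)
Lemma limit_ODE_slope_gap (K : realType) (m x : K) (S : K -> K) : 1 < m ->
  limit_ODE m S -> 0 <= x ->
  0 <= mu_bar m - derive1 S x <=
    mu_bar m * growth_rate m `^ (- m) * (1 + x) `^ (- m).
Proof.
move=> m1 H x0; have m0 : 0 < m by lra.
have mb := mu_bar_gt0 m0; have g0 := growth_rate_gt0 m0.
have HP := limit_ODE_tip_profile x m0 H.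
have xx : 0 <= x <= x by rewrite x0 lexx.
have Sle := (tip_profile_slope m0 HP xx).1.
have [S1ge Sge] := tip_profile_ge0 HP xx.
rewrite subr_ge0 Sle/=.
have e : derive1 S x ^+ 2 = mu_bar m ^+ 2 * (1 - (1 + S x) `^ (- m)).
  case: HP => S0 S10 dS dS1 _.
  have := @increment_norm_le_cst _
    (fun y => derive1 S y ^+ 2 + mu_bar m ^+ 2 * (1 + S y) `^ (- m))
    (fun x => 2 * derive1 S x * (tip_force m (S x) - tip_force m (S x))) 0 x 0.
  rewrite S0 S10 addr0 powR1 mul0r => h.
  have {h} : `|derive1 S x ^+ 2 + mu_bar m ^+ 2 * (1 + S x) `^ (- m)
      - (0 ^+ 2 + mu_bar m ^+ 2 * 1)| <= 0.
    apply: h => [//|y yx|y yx]; last by rewrite subrr mulr0 normr0.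
    apply: is_derive_energy => //; [|exact: dS|exact: dS1].
    exact: (tip_profile_ge0 (limit_ODE_tip_profile x m0 H) yx).2.
  by rewrite normr_le0 => /eqP; lra.
have gr : (1 + S x) `^ (- m) <= growth_rate m `^ (- m) * (1 + x) `^ (- m).
  rewrite -powRM ?(ltW g0)//; last by lra.
  apply: le_powRN; [exact: ltW|by rewrite mulr_gt0//; lra|].
  by apply: (tip_profile_growth m1 (ltW g0) HP).
apply: (@le_trans _ _ (mu_bar m * (1 + S x) `^ (- m))); last first.
  by rewrite -mulrA ler_wpM2l// ltW.
rewrite -(ler_pM2l mb).
have : 0 <= derive1 S x * (mu_bar m - derive1 S x) by rewrite mulr_ge0// subr_ge0.
have : mu_bar m * (mu_bar m - derive1 S x) + derive1 S x * (mu_bar m - derive1 S x)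
  = mu_bar m ^+ 2 - derive1 S x ^+ 2 by ring.
by rewrite e; lra.
Qed.

(** By parts, x S' - S is the integral of y S''(y) over [0, x], so the difference is the tail of
    [kappa_bar]. The integrand is O((1+y)^-m) by linear growth, integrable because m > 1. *)
Lemma kappa_bar_tail (K : realType) (m : K) (S : K -> K) : 1 < m ->
  limit_ODE m S -> exists2 C : K, 0 <= C & forall x : K, 0 <= x ->
    0 <= kappa_bar S - (x * derive1 S x - S x) <= C * (1 + x) `^ (1 - m).
Proof.
move=> m1 H; have m0 : 0 < m by lra.
have g0 := growth_rate_gt0 m0; have [dS dS1 S0 S10] := limit_ODE_is_derive H.
set c := growth_rate m in g0.
pose B := 2 * c `^ (- (m + 1)).
have B0 : 0 <= B by rewrite mulr_ge0 ?powR_ge0.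
pose C := B / (m - 1).
have C0 : 0 <= C by rewrite divr_ge0//; lra.
(* h is an antiderivative of x S''(x), hence kappa_bar is its limit. *)
pose h (x : K) := x * derive1 S x - S x.
have dh (x : K) : is_derive x 1 h (x * tip_force m (S x)).
  have ? := dS x; have ? := dS1 x.
  by apply: is_derive_eqP; rewrite /GRing.scale/=; ring.
pose g x : K := - C * (1 + x) `^ (1 - m).
have dg (x : K) : 0 <= x -> is_derive x 1 g (B * (1 + x) `^ (- m)).
  move=> x0; have x1 : 0 < 1 + x by lra.
  have ? := is_derive1_powR_onep (1 - m) x1.
  have -> : - m = 1 - m - 1 by ring.
  by apply: is_derive_eqP; rewrite /GRing.scale/= /C; field; lra.
have tf_le (x : K) : 0 <= x -> x * tip_force m (S x) <= B * (1 + x) `^ (- m).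
  move=> x0; have x1 : 0 < 1 + x by lra.
  have xx : 0 <= x <= x by rewrite x0 lexx.
  have := tip_profile_growth m1 (ltW g0) (limit_ODE_tip_profile x m0 H) xx.
  rewrite -/c => cx.
  have e : - m = - (m + 1) + 1 by ring.
  have -> : B * (1 + x) `^ (- m) = (1 + x) * (2 * (c * (1 + x)) `^ (- (m + 1))).
    by rewrite powRM ?ltW// e powRD1// /B; ring.
  rewrite ler_pM ?tip_force_ge0//; first by lra.
  rewrite ler_pM ?powR_ge0 ?divr_ge0//; [lra| |].
    by rewrite ler_pdivrMr; lra.
  by apply: le_powRN cx; [lra|exact: mulr_gt0].
have hmono (x y : K) : 0 <= x -> x <= y -> h x <= h y.
  move=> x0 xy; rewrite -subr_ge0 -[leLHS](mul0r (y - x)).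
  apply: (@increment_ge_cst _ h (fun x => x * tip_force m (S x))) => // z zxy.
  by rewrite mulr_ge0 ?tip_force_ge0//; lra.
have hle (x y : K) : 0 <= x -> x <= y -> h y <= h x + C * (1 + x) `^ (1 - m).
  move=> x0 xy.
  have : h y - h x <= g y - g x.
    apply: (@increment_le _ h (fun x => x * tip_force m (S x)) g
      (fun x => B * (1 + x) `^ (- m))) => [|z zxy|z zxy].
    - exact: xy.
    - by apply: dg; lra.
    - by apply: tf_le; lra.
  have : 0 <= C * (1 + y) `^ (1 - m) by rewrite mulr_ge0 ?powR_ge0.
  by rewrite /g; lra.
(* [h] is only known to be monotone on [0, +oo[; extending it by the constant [h 0] makes it
   monotone on the whole line, so that its limit is a supremum. *)
pose hm (x : K) := h (Num.max 0 x).
have ubm (x : K) : 0 <= x -> ubound (range hm) (h x + C * (1 + x) `^ (1 - m)).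
  move=> x0 _ [y _ <-]; rewrite /hm.
  set z := Num.max 0 y; have z0 : 0 <= z by rewrite /z le_max lexx.
  have [xz|/ltW zx] := leP x z; first exact: hle.
  apply: le_trans (hmono _ _ z0 zx) _.
  by rewrite lerDl mulr_ge0 ?powR_ge0.
have hub : has_ubound (range hm) by exists (h 0 + C * (1 + 0) `^ (1 - m)); exact: ubm.
have hm_cvg : hm x @[x --> +oo] --> sup (range hm).
  apply: nondecreasing_cvgr => // x y xy; apply: hmono; first by rewrite le_max lexx.
  by rewrite ge_max !le_max lexx xy orbT.
have kE : kappa_bar S = sup (range hm).
  rewrite /kappa_bar (@Rintegral_ge0_continuous_FTC2y _ _ h 0 (sup (range hm))).
  - by rewrite /h S0 mul0r !subr0.
  - move=> x x0; have [_ _ _ -> _] := H.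
    by rewrite mulr_ge0// -/(tip_force m (S x)) tip_force_ge0.
  - apply: continuous_subspaceT => x.
    have [_ _ _ ode _] := H.
    have -> : (fun x => x * derive1n 2 S x) = (fun x => x * tip_force m (S x)).
      by apply/funext => y; rewrite ode.
    have [Sm1 _ _ _ _] := H.
    have p1 : 0 < 1 + S x by have := Sm1 x; lra.
    have d1 : is_derive x 1 (fun y => 1 + S y) (derive1 S x).
      by have ? := dS x; apply: is_derive_eqP; rewrite /GRing.scale/=; ring.
    have ? := @is_derive1_powR_comp _ (fun y => 1 + S y) (- (m + 1)) x _ p1 d1.
    have [d2 hd2] : exists d, is_derive x 1
        (fun y => 2 / (m + 1) * (1 + S y) `^ (- (m + 1))) d.
      by eexists; apply: is_derive_eqP.
    have c1 : {for x, continuous (fun y : K => y)} by exact: cvg_id.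
    exact: continuousM c1 (is_derive_continuous hd2).
  - apply: cvg_trans hm_cvg; apply: near_eq_cvg; near=> x.
    rewrite /hm max_r//; near: x; exact: nbhs_pinfty_ge.
  - by move=> x _; case: (dh x).
  - by apply: cvg_at_right_filter; exact: is_derive_continuous (dh 0).
  - move=> x _; have [_ _ _ -> _] := H.
    by rewrite derive1E; case: (dh x).
exists C => // x x0; rewrite kE -/(h x); apply/andP; split.
  rewrite subr_ge0; apply: ub_le_sup => //; exists x => //.
  by rewrite /hm max_r.
rewrite lerBlDl; apply: ge_sup; first by exists (hm 0); exists 0.
exact: ubm.
Unshelve. all: by end_near. Qed.

(** * Averages as increments of primitives *)

Lemma continuous_integrable_itv (K : realType) (f : K -> K) (a b : K) :
  continuous f -> lebesgue_measure.-integrable `[a, b] (EFin \o f).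
Proof.
move=> cf; apply: continuous_compact_integrable; first exact: segment_compact.
exact: continuous_subspaceT.
Qed.

(** It turns averages into differences F(x + 1/2) - F(x - 1/2), after which integrals are estimated
    by the increment lemmas alone. *)
Lemma local_primitive (K : realType) (f : K -> K) (a b : K) : continuous f ->
  exists2 F : K -> K, forall x, a < x < b -> is_derive x 1 F (f x)
  & forall u v, a < u -> u < v -> v < b ->
      \int[lebesgue_measure]_(y in `[u, v]) f y = F v - F u.
Proof.
move=> cf; exists (fun x => \int[lebesgue_measure]_(y in `[a, x]) f y).
  move=> x /andP[ax xb].
  have [d e] := continuous_FTC1_closed xb (continuous_integrable_itv a b cf) ax (cf x).
  by apply: DeriveDef; [exact: d|rewrite -derive1E; exact: e].
move=> u v au uv vb.
rewrite (Rintegral_itvB (continuous_integrable_itv a v cf)) ?bnd_simp ?ltW//.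
rewrite Rintegral_itv_obnd_cbnd//.
apply: integrableS (continuous_integrable_itv u v cf) => //.
exact: subset_itv_oc_cc.
Qed.

Lemma averaging_is_derive (K : realType) (f : K -> K) (x : K) : continuous f ->
  is_derive x 1 (averaging f) (f (x + 2^-1) - f (x - 2^-1)).
Proof.
move=> cf; have [F dF FE] := local_primitive (x - 2) (x + 2) cf.
pose A y := F (y + 2^-1) - F (y - 2^-1).
have dA : is_derive x 1 A (f (x + 2^-1) - f (x - 2^-1)).
  have h1 := @is_derive1_comp_add _ F (2^-1) x _ (dF (x + 2^-1) _).
  have h2 := @is_derive1_comp_add _ F (- 2^-1) x _ (dF (x - 2^-1) _).
  by apply: is_deriveB; [apply: h1|apply: h2]; lra.
have near_eq : \near x, A x = averaging f x.
  near=> y; rewrite /averaging FE//.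
  - suff : x - 1 < y by lra.
    by near: y; apply: lt_nbhsr; lra.
  - by lra.
  - suff : y < x + 1 by lra.
    by near: y; apply: lt_nbhsl; lra.
have [dv e] := dA; split; first exact: near_eq_derivable near_eq dv.
by rewrite -(near_eq_derive _ near_eq).
Unshelve. all: by end_near. Qed.

(** * The derivative of the potential *)

Definition dPhi (K : realType) (m r : K) : K :=
  ((1 - r) `^ (- (m + 1)) - 1) / (m + 1).

Lemma derive1_Phi (K : realType) (m r : K) : 0 < m -> r < 1 ->
  derive1 (Phi m) r = dPhi m r.
Proof.
move=> m0 r1; have p1 : 0 < 1 - r by lra.
have d1 : is_derive r 1 (fun y => 1 - y) (-1).
  by apply: is_derive_eqP; rewrite /GRing.scale/=; ring.
have dp := @is_derive1_powR_comp _ (fun y => 1 - y) (- m) r _ p1 d1.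
suff : is_derive r 1 (Phi m) (dPhi m r) by case=> _ e; rewrite derive1E.
rewrite /Phi; apply: is_derive_eqP.
by rewrite /dPhi /GRing.scale/= opprD; field; lra.
Qed.

Lemma is_derive_dPhi (K : realType) (m r : K) : 0 < m -> r < 1 ->
  is_derive r 1 (dPhi m) ((1 - r) `^ (- (m + 2))).
Proof.
move=> m0 r1; have p1 : 0 < 1 - r by lra.
have d1 : is_derive r 1 (fun y => 1 - y) (-1).
  by apply: is_derive_eqP; rewrite /GRing.scale/=; ring.
have dp := @is_derive1_powR_comp _ (fun y => 1 - y) (- (m + 1)) r _ p1 d1.
have -> : - (m + 2) = - (m + 1) - 1 by ring.
rewrite /dPhi; apply: is_derive_eqP.
by rewrite /GRing.scale/=; field; lra.
Qed.

Lemma le_dPhi (K : realType) (m r s : K) : 0 < m -> r <= s -> s < 1 ->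
  dPhi m r <= dPhi m s.
Proof.
move=> m0 rs s1; rewrite ler_wpM2r ?invr_ge0 ?lerB ?le_powRN//; lra.
Qed.

Lemma dPhi0 (K : realType) (m : K) : dPhi m 0 = 0.
Proof. by rewrite /dPhi subr0 powR1 subrr mul0r. Qed.

Lemma dPhi_ge0 (K : realType) (m r : K) : 0 < m -> 0 <= r -> r < 1 -> 0 <= dPhi m r.
Proof.
by move=> m0 r0 r1; have := le_dPhi m0 r0 r1; rewrite dPhi0.
Qed.

(** Phi'' = (1-r)^-(m+2) is at least 1 on [0, 1[. The linear lower bound is what yields the lower
    bound on the speed. *)
Lemma dPhi_ge_id (K : realType) (m r : K) : 0 < m -> 0 <= r -> r < 1 -> r <= dPhi m r.
Proof.
move=> m0 r0 r1.
have : 1 * (r - 0) <= dPhi m r - dPhi m 0.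
  apply: (@increment_ge_cst _ (dPhi m) (fun r => (1 - r) `^ (- (m + 2)))) => //.
    by move=> x xr; apply: is_derive_dPhi => //; lra.
  move=> x xr; have h1 : 0 <= m + 2 by lra.
  have h2 : 0 < 1 - x by lra.
  have h3 : 1 - x <= 1 by lra.
  by have := le_powRN h1 h2 h3; rewrite powR1.
by rewrite dPhi0; lra.
Qed.

(** * Uniform bounds for a solitary wave *)

Lemma norm2_itv_le (K : realType) (f : K -> K) (c u v : K) : continuous f ->
  0 <= c -> norm2 f = c%:E ->
  \int[lebesgue_measure]_(x in `[u, v]) (f x ^+ 2) <= c ^+ 2.
Proof.
move=> cf c0 nf.
have cf2 : continuous (fun x => f x ^+ 2).
  by move=> x; rewrite /continuous_at expr2; apply: continuousM; exact: cf.
rewrite -lee_fin /Rintegral fineK; last first.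
  exact: integrable_fin_num (continuous_integrable_itv u v cf2).
have -> : (c ^+ 2)%:E = (\int[lebesgue_measure]_x ((f x ^+ 2)%:E))%E.
  have := @poweR_Lnorm _ _ _
    (lebesgue_measure : {measure set (measurableTypeR K) -> \bar K}) (EFin \o f) 2.
  rewrite -/(norm2 f) nf poweR_EFin powR_mulrn// => -> //.
  apply: eq_integral => x _ /=.
  by rewrite powR_mulrn// real_normK ?num_real.
apply: (@ge0_subset_integral _ (measurableTypeR K) K lebesgue_measure `[u, v] setT) => //.
  by apply/measurable_EFinP; exact: continuous_measurable_fun.
by move=> x _; rewrite lee_fin sqr_ge0.
Qed.

Lemma norm2_neq0 (K : realType) (f : K -> K) (c : K) : 0 < c ->
  norm2 f = c%:E -> exists x, f x != 0.
Proof.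
move=> c0 nf; apply: contrapT => h.
have f0 : f = cst 0.
  by apply/funext => x; apply/eqP/negPn/negP => fx; apply: h; exists x.
move: nf; rewrite /norm2 f0 (_ : EFin \o cst 0 = cst 0%E)// Lnorm0//.
by case=> e; rewrite -e ltxx in c0.
Qed.

(** The definition of [unimodal] compares points of an open half-line only; continuity includes
    0. *)
Lemma unimodal_noninc (K : realType) (f : K -> K) : unimodal f ->
  {for 0, continuous f} -> forall x y, 0 <= x -> x <= y -> f y <= f x.
Proof.
move=> [_ fle] f0.
have hpos x y : 0 < x -> x <= y -> f y <= f x.
  by move=> x0 xy; apply: fle; rewrite // in_itv/= andbT// (lt_le_trans x0).
move=> x y; rewrite le_eqVlt => /predU1P[<-|]; last exact: hpos.
rewrite le_eqVlt => /predU1P[<-//|y0].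
apply: (@cvgr_to_ge _ (0^'+) _ _ f); first exact: cvg_at_right_filter f0.
near=> t; apply: hpos => //.
by near: t; exact: nbhs_right_le.
Unshelve. all: by end_near. Qed.

(** The two integral equations in differentiated form, together with bounds in which delta does not
    occur; this makes the later constants common to the whole family. *)
Record wave_facts (K : realType) (m : K) (V R : K -> K) (sigma : K) : Prop := {
  wave_dR : forall x : K, is_derive x 1 R (V (x + 2^-1) - V (x - 2^-1));
  wave_dV : forall x : K, is_derive x 1 V
    ((dPhi m (R (x + 2^-1)) - dPhi m (R (x - 2^-1))) / sigma);
  wave_R_itv : forall x, 0 <= R x < 1;
  wave_V_ge0 : forall x, 0 <= V x;
  wave_R_even : forall x, R (- x) = R x;
  wave_V_even : forall x, V (- x) = V x;
  wave_R_noninc : forall x y, 0 <= x -> x <= y -> R y <= R x;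
  wave_V_noninc : forall x y, 0 <= x -> x <= y -> V y <= V x;
  wave_R_half : R 2^-1 <= 3 / 4;
  wave_R_three_halves : R (3 / 2) <= V 1;
  wave_V_one : sigma * V 1 <= dPhi m (R 2^-1);
  wave_speed : 1 / 4 <= sigma }.

(** For the speed: sigma V(1/2) is the integral of Phi'(R) over [0, 1], at least R(1/2)/2, and
    R(1/2) is the integral of V over [0, 1], at least V(1/2)/2. Hence sigma >= 1/4 after division by
    V(1/2). *)
Lemma solitary_wave_facts (K : realType) (m c sigma : K) (V R : K -> K) :
  0 < m -> solitary_wave m V R sigma -> wave_profile V -> wave_profile R ->
  0 < c <= 1 -> norm2 V = c%:E -> (forall x, 0 <= R x < 1) ->
  wave_facts m V R sigma.
Proof.
move=> m0 [_ s0 RE _ sVE] [_ [dV _ _ _] V0 Veven Vuni] [_ [dR _ _ _] _ Reven Runi].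
move=> /andP[c0 c1] nV R01.
have cV : continuous V.
  by move=> x; apply: differentiable_continuous; apply/derivable1_diffP.
have cR : continuous R.
  by move=> x; apply: differentiable_continuous; apply/derivable1_diffP.
pose p x := dPhi m (R x).
have cp : continuous p.
  move=> x; have /andP[_ r1] := R01 x.
  have cD := is_derive_continuous (is_derive_dPhi m0 r1).
  exact: continuous_comp (cR x) cD.
have pE x : sigma * V x = averaging p x.
  rewrite sVE; congr averaging; apply/funext => y /=.
  by rewrite derive1_Phi//; have /andP[] := R01 y.
have Rn := unimodal_noninc Runi (cR 0); have Vn := unimodal_noninc Vuni (cV 0).
have p0 x : 0 <= p x by have /andP[? ?] := R01 x; exact: dPhi_ge0.
have pn x y : 0 <= x -> x <= y -> p y <= p x.
  by move=> x0 xy; have /andP[_ ?] := R01 x; apply: le_dPhi => //; exact: Rn.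
have [F dF FE] := local_primitive (-5) 5 cV.
have [G dG GE] := local_primitive (-5) 5 cp.
have cV2 : continuous (fun x => V x ^+ 2).
  by move=> x; rewrite /continuous_at expr2; apply: continuousM; exact: cV.
have [W dW WE] := local_primitive (-5) 5 cV2.
have RF x a b : -4 < x < 4 -> x - 2^-1 = a -> x + 2^-1 = b -> R x = F b - F a.
  by move=> x4 <- <-; rewrite RE /averaging FE//; lra.
have VG x a b : -4 < x < 4 -> x - 2^-1 = a -> x + 2^-1 = b -> sigma * V x = G b - G a.
  by move=> x4 <- <-; rewrite pE /averaging GE//; lra.
have R12 : R 2^-1 = F 1 - F 0 by apply: RF; lra.
have RN12 : R 2^-1 = F 0 - F (-1) by rewrite -Reven; apply: RF; lra.
have R0E : R 0 = F 2^-1 - F (- 2^-1) by apply: RF; lra.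
have V12 : sigma * V 2^-1 = G 1 - G 0 by apply: VG; lra.
have F01 : V 2^-1 * 2^-1 <= F 1 - F 0.
  have : V 2^-1 * (2^-1 - 0) <= F 2^-1 - F 0.
    apply: increment_ge_cst => [|x xx|x xx]; [lra|apply: dF; lra|apply: Vn; lra].
  have : 0 * (1 - 2^-1) <= F 1 - F 2^-1.
    by apply: (@increment_ge_cst _ F V) => [|x xx|x xx //]; [lra|apply: dF; lra].
  by lra.
have G01 : R 2^-1 * 2^-1 <= G 1 - G 0.
  have : R 2^-1 * (2^-1 - 0) <= G 2^-1 - G 0.
    apply: (@increment_ge_cst _ G p) => [|x xx|x xx]; [lra|apply: dG; lra|].
    have /andP[r0 r1] := R01 x.
    by apply: le_trans (dPhi_ge_id m0 r0 r1); apply: Rn; lra.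
  have : 0 * (1 - 2^-1) <= G 1 - G 2^-1.
    by apply: (@increment_ge_cst _ G p) => [|x xx|x xx //]; [lra|apply: dG; lra].
  by lra.
(* If V(1/2) = 0, the two inequalities above force the integral of V over [0, 1] to vanish. By
   monotonicity, continuity at 0 and evenness V is then 0 everywhere, against its positive norm. *)
have V12pos : 0 < V 2^-1.
  rewrite lt_neqAle V0 andbT; apply/negP => /eqP V120.
  have R120 : F 1 - F 0 <= 0 by rewrite -V120 mulr0 in V12; lra.
  have Vpos x : 0 < x -> V x <= 0.
    move=> x0; have [x12|/ltW x12] := leP x 2^-1; last by rewrite [leRHS]V120 Vn; lra.
    have h1 : V x * (x - 0) <= F x - F 0.
      apply: (@increment_ge_cst _ F V) => [|y yx|y yx]; [lra|apply: dF; lra|apply: Vn; lra].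
    have h2 : 0 * (1 - x) <= F 1 - F x.
      by apply: (@increment_ge_cst _ F V) => [|y yx|y yx //]; [lra|apply: dF; lra].
    have : V x * x <= 0 by lra.
    by rewrite pmulr_lle0.
  have VZ : V 0 <= 0.
    apply: (@cvgr_to_le _ (0^'+) _ _ V); first exact: cvg_at_right_filter (cV 0).
    by near=> t; apply: Vpos.
  have [x] := norm2_neq0 c0 nV.
  apply/negP; rewrite negbK eq_le V0 andbT.
  have [x0|x0|->] := ltgtP x 0; [|exact: Vpos|exact: VZ].
  by rewrite -Veven Vpos// oppr_gt0.
(* V^2 >= 2 V - 1 on [-1/2, 1/2] and V^2 >= V - 1/4 on the rest of [-1, 1];
   integrate, with |V|_2 <= 1. *)
have Rhalf : R 2^-1 <= 3 / 4.
  have sq (x : K) : 0 <= V x ^+ 2 - 2 * V x + 1 /\ 0 <= V x ^+ 2 - V x + 1 / 4.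
    split.
      have -> : V x ^+ 2 - 2 * V x + 1 = (V x - 1) ^+ 2 by ring.
      by rewrite sqr_ge0.
    have -> : V x ^+ 2 - V x + 1 / 4 = (V x - 1 / 2) ^+ 2 by field.
    by rewrite sqr_ge0.
  have W1 : W 1 - W (-1) <= 1.
    rewrite -WE; [|lra|lra|lra].
    apply: le_trans (norm2_itv_le _ _ cV (ltW c0) nV) _.
    by rewrite expr2 mulr_ile1// ltW.
  have inc (a b k l : K) : -1 <= a -> a <= b -> b <= 1 ->
      (forall x : K, 0 <= V x ^+ 2 - k * V x + l) ->
      k * (F b - F a) - l * (b - a) <= W b - W a.
    move=> a1 ab b1 h.
    have := @increment_le _ (fun x => k * F x - l * x) (fun x => k * V x - l) W
      (fun x => V x ^+ 2) a b ab.
    have -> : k * F b - l * b - (k * F a - l * a) = k * (F b - F a) - l * (b - a) by ring.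
    apply=> [x xx|x xx|x xx].
    - have ? : is_derive x 1 F (V x) by apply: dF; lra.
      by apply: is_derive_eqP; rewrite /GRing.scale/=; ring.
    - by apply: dW; lra.
    - by have := h x; lra.
  have h1 : 1 * (F 1 - F 2^-1) - 1 / 4 * (1 - 2^-1) <= W 1 - W 2^-1.
    by apply: inc => [|||x]; [lra|lra|lra|have := (sq x).2; lra].
  have h2 : 1 * (F (- 2^-1) - F (-1)) - 1 / 4 * (- 2^-1 - - 1) <= W (- 2^-1) - W (-1).
    by apply: inc => [|||x]; [lra|lra|lra|have := (sq x).2; lra].
  have h3 : 2 * (F 2^-1 - F (- 2^-1)) - 1 * (2^-1 - - 2^-1) <= W 2^-1 - W (- 2^-1).
    by apply: inc => [|||x]; [lra|lra|lra|exact: (sq x).1].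
  (* V has integral 2 R(1/2) over [-1, 1], so the three inequalities add up to R(0) + 2 R(1/2) <=
     9/4. *)
  have : R 2^-1 <= R 0 by apply: Rn; lra.
  by lra.
split => //.
- move=> x; have -> : R = averaging V by apply/funext.
  exact: averaging_is_derive.
- move=> x; have -> : V = (fun y => averaging p y / sigma).
    by apply/funext => y; rewrite -pE mulrAC mulfV ?mul1r// gt_eqF.
  have ? := averaging_is_derive x cp.
  by apply: is_derive_eqP; rewrite /GRing.scale/= /p; ring.
- have -> : R (3 / 2) = F 2 - F 1 by apply: RF; lra.
  have -> : V 1 = V 1 * (2 - 1) by ring.
  by apply: (@increment_le_cst _ F V) => [|x xx|x xx]; [lra|apply: dF; lra|apply: Vn; lra].
- have -> : sigma * V 1 = G (3 / 2) - G 2^-1 by apply: VG; lra.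
  have -> : dPhi m (R 2^-1) = p 2^-1 * (3 / 2 - 2^-1) by rewrite /p; field.
  by apply: (@increment_le_cst _ G p) => [|x xx|x xx]; [lra|apply: dG; lra|apply: pn; lra].
- rewrite -(ler_pM2r V12pos); lra.
Unshelve. all: by end_near. Qed.

(** * The rescaled wave at the tip *)

Lemma tip_force_rescaled (K : realType) (m e r : K) : 0 < m -> 0 < e -> r < 1 ->
  tip_force m ((1 - r) / e - 1) = e `^ (m + 1) * (2 * dPhi m r + 2 / (m + 1)).
Proof.
move=> m0 e0 r1; rewrite /tip_force /dPhi.
have -> : 1 + ((1 - r) / e - 1) = (1 - r) * e^-1 by ring.
rewrite powRM ?invr_ge0 ?(ltW e0) ?subr_ge0 ?(ltW r1)//.
have -> : e^-1 `^ (- (m + 1)) = e `^ (m + 1).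
  by rewrite -powR_inv1 ?(ltW e0)// -powRrM mulrNN mul1r.
by field; lra.
Qed.

Lemma wave_dPhi_bounds (K : realType) (m sigma x : K) (V R : K -> K) :
  0 < m -> wave_facts m V R sigma -> 2^-1 <= `|x| ->
  0 <= dPhi m (R x) <= dPhi m (3 / 4).
Proof.
move=> m0 H hx; have /andP[r0 r1] := wave_R_itv H x.
rewrite dPhi_ge0//= le_dPhi//; last by lra.
apply: le_trans (wave_R_half H).
have -> : R x = R `|x| by case: (ger0P x) => // _; rewrite (wave_R_even H).
by apply: (wave_R_noninc H) => //; lra.
Qed.

(** [mu] is characterized by its sign and its square, so that the scaling identities are field
    computations without a square root. *)
Record tip_scaling (K : realType) (m : K) (V R : K -> K) (sigma mu : K) : Prop := {
  scaling_wave : wave_facts m V R sigma;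
  scaling_gt0 : 0 < mu;
  scaling_sqr : mu ^+ 2 = sigma * (1 - R 0) `^ (m + 2) }.

Lemma wave_eps_itv (K : realType) (m sigma : K) (V R : K -> K) :
  wave_facts m V R sigma -> 0 < 1 - R 0 <= 1.
Proof. by move=> H; have := wave_R_itv H 0; lra. Qed.

Lemma wave_speed_gt0 (K : realType) (m sigma : K) (V R : K -> K) :
  wave_facts m V R sigma -> 0 < sigma.
Proof. by move=> H; have := wave_speed H; lra. Qed.

(** The left side is the factor produced by differentiating the rescaled profile twice, V'
    contributing 1/sigma. The choice of mu makes it eps^(m+1), the factor that normalizes Phi' at
    the tip. *)
Lemma scaling_ratio (K : realType) (m sigma mu : K) (V R : K -> K) :
  tip_scaling m V R sigma mu ->
  mu ^+ 2 / ((1 - R 0) * sigma) = (1 - R 0) `^ (m + 1).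
Proof.
case=> H mu0 ->; have /andP[e0 _] := wave_eps_itv H; have s0 := wave_speed_gt0 H.
rewrite (_ : m + 2 = m + 1 + 1); last by ring.
by rewrite powRD1//; field; rewrite !gt_eqF.
Qed.

Lemma scaling_half (K : realType) (m sigma mu : K) (V R : K -> K) :
  tip_scaling m V R sigma mu -> mu * (2 * mu)^-1 = 2^-1.
Proof. by case=> _ mu0 _; field; rewrite gt_eqF. Qed.

Definition tip_S (K : realType) (mu : K) (R : K -> K) (x : K) : K :=
  (1 - R (mu * x)) / (1 - R 0) - 1.

Definition tip_S1 (K : realType) (mu : K) (V R : K -> K) (x : K) : K :=
  - (mu / (1 - R 0)) * (V (mu * x + 2^-1) - V (mu * x - 2^-1)).

Definition tip_S2 (K : realType) (m mu : K) (R : K -> K) (x : K) : K :=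
  (1 - R 0) `^ (m + 1) *
  (2 * dPhi m (R (mu * x)) - dPhi m (R (mu * x + 1)) - dPhi m (R (mu * x - 1))).

(** 2 / (m+1) comes from the constant -1 inside [dPhi], counted twice; the other term bounds the two
    shifted values of Phi'(R). *)
Definition tip_error (K : realType) (m : K) : K := 2 / (m + 1) + 2 * dPhi m (3 / 4).

Lemma dPhi34_ge0 (K : realType) (m : K) : 0 < m -> 0 <= dPhi m (3 / 4).
Proof. by move=> m0; apply: dPhi_ge0 => //; lra. Qed.

Lemma tip_error_gt0 (K : realType) (m : K) : 0 < m -> 0 < tip_error m.
Proof.
move=> m0; have P0 := dPhi34_ge0 m0; have : 0 < 2 / (m + 1) by rewrite divr_gt0//; lra.
by rewrite /tip_error; lra.
Qed.

Lemma is_derive_wave_R (K : realType) (m sigma a b x : K) (V R : K -> K) :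
  wave_facts m V R sigma -> is_derive x 1 (fun y => R (a + b * y))
  ((V (a + b * x + 2^-1) - V (a + b * x - 2^-1)) * b).
Proof. by move=> H; exact: is_derive1_comp_affine (wave_dR H _). Qed.

Lemma is_derive_wave_V (K : realType) (m sigma a b x : K) (V R : K -> K) :
  wave_facts m V R sigma -> is_derive x 1 (fun y => V (a + b * y))
  ((dPhi m (R (a + b * x + 2^-1)) - dPhi m (R (a + b * x - 2^-1))) / sigma * b).
Proof. by move=> H; exact: is_derive1_comp_affine (wave_dV H _). Qed.

Lemma is_derive_tip_S (K : realType) (m sigma mu x : K) (V R : K -> K) :
  tip_scaling m V R sigma mu -> is_derive x 1 (tip_S mu R) (tip_S1 mu V R x).
Proof.
case=> H _ _; have /andP[e0 _] := wave_eps_itv H.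
have h := is_derive_wave_R 0 mu x H; rewrite /tip_S /tip_S1.
have -> : (fun y => (1 - R (mu * y)) / (1 - R 0) - 1) =
    (fun y => (1 - R (0 + mu * y)) / (1 - R 0) - 1).
  by apply/funext => y; rewrite add0r.
by apply: is_derive_eqP; rewrite /GRing.scale/= !add0r; field; rewrite gt_eqF.
Qed.

Lemma is_derive_tip_S1 (K : realType) (m sigma mu x : K) (V R : K -> K) :
  tip_scaling m V R sigma mu -> is_derive x 1 (tip_S1 mu V R) (tip_S2 m mu R x).
Proof.
move=> HS; have [H _ _] := HS; have /andP[e0 _] := wave_eps_itv H.
have s0 := wave_speed_gt0 H.
have h1 := is_derive_wave_V 2^-1 mu x H; have h2 := is_derive_wave_V (- 2^-1) mu x H.
have -> : tip_S1 mu V R =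
    (fun y => - (mu / (1 - R 0)) * (V (2^-1 + mu * y) - V (- 2^-1 + mu * y))).
  by apply/funext => y; rewrite /tip_S1 ![_ + mu * y]addrC.
apply: is_derive_eqP; rewrite /GRing.scale/= /tip_S2 -(scaling_ratio HS).
have -> : 2^-1 + mu * x + 2^-1 = mu * x + 1 by field.
have -> : 2^-1 + mu * x - 2^-1 = mu * x by ring.
have -> : - 2^-1 + mu * x + 2^-1 = mu * x by ring.
have -> : - 2^-1 + mu * x - 2^-1 = mu * x - 1 by field.
by field; rewrite !gt_eqF.
Qed.

Lemma tip_force_tip_S (K : realType) (m sigma mu x : K) (V R : K -> K) :
  0 < m -> wave_facts m V R sigma -> tip_force m (tip_S mu R x) =
    (1 - R 0) `^ (m + 1) * (2 * dPhi m (R (mu * x)) + 2 / (m + 1)).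
Proof.
move=> m0 H; have /andP[e0 _] := wave_eps_itv H.
by apply: tip_force_rescaled => //; have := wave_R_itv H (mu * x); lra.
Qed.

(** On [0, X] the point mu x lies in [0, 1/2], so both shifted points have absolute value at least
    1/2, which bounds the defect, and at least mu x, which gives S'' >= 0 by unimodality. *)
Lemma tip_S_profile (K : realType) (m sigma mu : K) (V R : K -> K) :
  0 < m -> tip_scaling m V R sigma mu ->
  tip_profile m (tip_error m * (1 - R 0) `^ (m + 1)) (2 * mu)^-1
    (tip_S mu R) (tip_S1 mu V R) (tip_S2 m mu R).
Proof.
move=> m0 HS; have [H mu0 _] := HS; have /andP[e0 _] := wave_eps_itv H.
have L0 : 0 <= (1 - R 0) `^ (m + 1) by exact: powR_ge0.
split=> [||x _|x _|x /andP[x0 xX]].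
- by rewrite /tip_S mulr0 divff ?subrr// gt_eqF.
- by rewrite /tip_S1 mulr0 add0r sub0r (wave_V_even H) subrr mulr0.
- exact: is_derive_tip_S HS.
- exact: is_derive_tip_S1 HS.
have xmu0 : 0 <= mu * x by rewrite mulr_ge0// ltW.
have xmu1 : mu * x <= 2^-1 by rewrite -(scaling_half HS) ler_pM2l.
have R1 y : R y < 1 by have /andP[] := wave_R_itv H y.
have P1 : dPhi m (R (mu * x + 1)) <= dPhi m (R (mu * x)).
  by apply: le_dPhi => //; apply: (wave_R_noninc H); lra.
have P2 : dPhi m (R (mu * x - 1)) <= dPhi m (R (mu * x)).
  apply: le_dPhi => //; rewrite -(wave_R_even H (_ - _)) opprB.
  by apply: (wave_R_noninc H); lra.
have n1 : 2^-1 <= `|mu * x + 1| by rewrite ger0_norm; lra.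
have n2 : 2^-1 <= `|mu * x - 1| by rewrite ler0_norm; lra.
have /andP[P3 P3'] := wave_dPhi_bounds m0 H n1.
have /andP[P4 P4'] := wave_dPhi_bounds m0 H n2.
rewrite (tip_force_tip_S _ _ m0 H) /tip_S2 [tip_error m * _]mulrC -mulrBr; split.
  by rewrite mulr_ge0//; lra.
have h : 0 < 2 / (m + 1) by rewrite divr_gt0//; lra.
by rewrite !ler_wpM2l// /tip_error; lra.
Qed.

(** At the end of the interval mu x = 1/2, so the quantity is 1 - R(1/2). This known end value ties
    the length of the interval to 1/eps. *)
Lemma tip_S_end (K : realType) (m sigma mu : K) (V R : K -> K) :
  tip_scaling m V R sigma mu ->
  1 / 4 <= (1 - R 0) * (1 + tip_S mu R (2 * mu)^-1) <= 1.
Proof.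
move=> HS; have [H mu0 _] := HS; have /andP[e0 _] := wave_eps_itv H.
have -> : (1 - R 0) * (1 + tip_S mu R (2 * mu)^-1) = 1 - R 2^-1.
  by rewrite /tip_S (scaling_half HS); field; rewrite gt_eqF.
by have := wave_R_half H; have := wave_R_itv H 2^-1; lra.
Qed.

Lemma tip_S_even (K : realType) (m sigma mu x : K) (V R : K -> K) :
  wave_facts m V R sigma -> tip_S mu R (- x) = tip_S mu R x.
Proof. by move=> H; rewrite /tip_S mulrN (wave_R_even H). Qed.

Lemma le_add1_of_sqr_le (K : realType) (x y : K) : x ^+ 2 <= y -> x <= 1 + y.
Proof.
move=> h; have h1 : 0 <= x ^+ 2 := sqr_ge0 x; have h2 : 0 <= (x - 1) ^+ 2 := sqr_ge0 _.
by rewrite (_ : (x - 1) ^+ 2 = x ^+ 2 - 2 * x + 1) in h2; [lra|ring].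
Qed.

Lemma tip_apriori (K : realType) (m : K) : 1 < m -> exists2 c : K, 0 < c &
  forall (V R : K -> K) (sigma mu : K), tip_scaling m V R sigma mu ->
    c <= (1 - R 0) * (1 + (2 * mu)^-1) <= c^-1 /\
    forall x, 0 <= x <= (2 * mu)^-1 -> c * (1 + x) <= 1 + tip_S mu R x.
Proof.
move=> m1; have m0 : 0 < m by lra.
have g0 := growth_rate_gt0 m0; have B0 := tip_error_gt0 m0; have mb := mu_bar_gt0 m0.
(* For eps <= eps0 the profile S grows linearly; for eps > eps0 the bound
   sigma >= 1/4 keeps the interval J bounded. *)
pose eps0 := growth_rate m / tip_error m.
have eps00 : 0 < eps0 by rewrite divr_gt0.
pose q := 4^-1 * eps0 `^ (m + 2).
have q0 : 0 < q by rewrite mulr_gt0 ?powR_gt0.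
pose Xm := 1 + (4 * q)^-1.
have Xm0 : 0 < Xm by rewrite addr_gt0// invr_gt0 mulr_gt0.
pose c1 := Num.min (growth_rate m) (1 + Xm)^-1.
have c10 : 0 < c1 by rewrite lt_min g0 invr_gt0; lra.
pose c := Num.min c1 (4 * (1 + mu_bar m))^-1.
have c0 : 0 < c by rewrite lt_min c10 invr_gt0; lra.
exists c => // V R sigma mu HS; have [H mu0 muE] := HS.
have /andP[e0 e1] := wave_eps_itv H.
have prof := tip_S_profile m0 HS; have pos := tip_profile_ge0 prof.
set e := 1 - R 0 in e0 e1 muE prof *; set X := (2 * mu)^-1 in prof pos *.
have X0 : 0 < X by rewrite invr_gt0 mulr_gt0.
have growth x : 0 <= x <= X -> c1 * (1 + x) <= 1 + tip_S mu R x.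
  move=> xX; have x1 : 0 <= 1 + x by lra.
  have [small|large] := leP e eps0.
    apply: le_trans (tip_profile_growth m1 _ prof xX).
      by rewrite ler_wpM2r// /c1 ge_min lexx.
    (* As e <= 1 and m + 1 >= 1, e^(m+1) <= e; this is why a threshold linear in e suffices. *)
    apply: (@le_trans _ _ (tip_error m * e)); last by rewrite mulrC -ler_pdivlMr.
    rewrite ler_pM2l//; apply: ge1r_powR; [exact/andP|lra].
  have qmu : q <= mu ^+ 2.
    rewrite muE /q ler_pM ?powR_ge0//; first by have := wave_speed H; lra.
    apply: ge0_ler_powR; rewrite ?nnegrE; lra.
  have XXm : X <= Xm.
    have X2 : X ^+ 2 <= (4 * q)^-1.
      have -> : X ^+ 2 = (4 * mu ^+ 2)^-1 by rewrite /X; field; rewrite gt_eqF.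
      rewrite lef_pV2 ?posrE ?ler_pM2l// mulr_gt0// exprn_gt0//.
    exact: le_add1_of_sqr_le X2.
  have h1 : c1 * (1 + x) <= (1 + Xm)^-1 * (1 + Xm).
    rewrite ler_pM ?(ltW c10)//; last by lra.
    by rewrite /c1 ge_min lexx orbT.
  have := (pos _ xX).2.
  have : (1 + Xm)^-1 * (1 + Xm) = 1 by rewrite mulVf// gt_eqF; lra.
  by lra.
have XX : 0 <= X <= X by rewrite ltW/=.
have cc1 : c <= c1 by rewrite /c ge_min lexx.
have /andP[end1 end2] := tip_S_end HS; rewrite -/e -/X in end1 end2.
split; last first.
  by move=> x xX; apply: le_trans (growth _ xX); rewrite ler_wpM2r//; lra.
(* Lower bound: S(X) <= mu_bar X and the end value 1/4, hence the term 4 (1 + mu_bar) in [c]. Upper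
   bound: linear growth and the end value 1. *)
apply/andP; split.
  have h : e * (1 + tip_S mu R X) <= e * ((1 + mu_bar m) * (1 + X)).
    rewrite ler_pM2l//; have := (tip_profile_slope m0 prof XX).2; lra.
  have : c * (4 * (1 + mu_bar m)) <= (4 * (1 + mu_bar m))^-1 * (4 * (1 + mu_bar m)).
    by rewrite ler_pM2r ?mulr_gt0//; [rewrite /c ge_min lexx orbT|lra].
  rewrite mulVf ?gt_eqF ?mulr_gt0//; last by lra.
  move=> h'; have mb1 : 0 < 4 * (1 + mu_bar m) by lra.
  rewrite -(ler_pM2r mb1).
  have -> : e * (1 + X) * (4 * (1 + mu_bar m)) = 4 * (e * ((1 + mu_bar m) * (1 + X))) by ring.
  by lra.
rewrite -[leRHS]mul1r ler_pdivlMr//; apply: le_trans end2.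
rewrite -mulrA ler_pM2l// mulrC; apply: le_trans (growth _ XX).
by rewrite ler_wpM2r//; lra.
Qed.

(** * The rescaled wave near -1 *)

Definition base_T (K : realType) (mu : K) (R : K -> K) (x : K) : K :=
  R (-1 + mu * x) / (1 - R 0).

Definition base_T1 (K : realType) (mu : K) (V R : K -> K) (x : K) : K :=
  mu / (1 - R 0) * (V (- 2^-1 + mu * x) - V (- (3 / 2) + mu * x)).

Definition base_T2 (K : realType) (m mu : K) (R : K -> K) (x : K) : K :=
  (1 - R 0) `^ (m + 1) *
  (dPhi m (R (mu * x)) - 2 * dPhi m (R (-1 + mu * x)) + dPhi m (R (-2 + mu * x))).

Lemma is_derive_base_T (K : realType) (m sigma mu x : K) (V R : K -> K) :
  tip_scaling m V R sigma mu -> is_derive x 1 (base_T mu R) (base_T1 mu V R x).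
Proof.
case=> H _ _; have /andP[e0 _] := wave_eps_itv H.
have h := is_derive_wave_R (-1) mu x H; rewrite /base_T /base_T1.
apply: is_derive_eqP; rewrite /GRing.scale/=.
have -> : -1 + mu * x + 2^-1 = - 2^-1 + mu * x by field.
have -> : -1 + mu * x - 2^-1 = - (3 / 2) + mu * x by field.
by field; rewrite gt_eqF.
Qed.

Lemma is_derive_base_T1 (K : realType) (m sigma mu x : K) (V R : K -> K) :
  tip_scaling m V R sigma mu ->
  is_derive x 1 (base_T1 mu V R) (base_T2 m mu R x).
Proof.
move=> HS; have [H _ _] := HS; have /andP[e0 _] := wave_eps_itv H.
have s0 := wave_speed_gt0 H.
have h1 := is_derive_wave_V (- 2^-1) mu x H.
have h2 := is_derive_wave_V (- (3 / 2)) mu x H.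
rewrite /base_T1; apply: is_derive_eqP.
rewrite /GRing.scale/= /base_T2 -(scaling_ratio HS).
have -> : - 2^-1 + mu * x + 2^-1 = mu * x by ring.
have -> : - 2^-1 + mu * x - 2^-1 = -1 + mu * x by field.
have -> : - (3 / 2) + mu * x + 2^-1 = -1 + mu * x by field.
have -> : - (3 / 2) + mu * x - 2^-1 = -2 + mu * x by field.
by field; rewrite !gt_eqF.
Qed.

Lemma is_derive_T_lim (K : realType) (m x : K) (S : K -> K) : limit_ODE m S ->
  is_derive x 1 (T_lim m S) (2^-1 * (derive1 S x + mu_bar m)).
Proof.
move=> /limit_ODE_is_derive[dS _ _ _]; have ? := dS x.
rewrite /T_lim; apply: is_derive_eqP; rewrite /GRing.scale/=; ring.
Qed.

Lemma is_derive_T_lim1 (K : realType) (m x : K) (S : K -> K) : limit_ODE m S ->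
  is_derive x 1 (fun y => 2^-1 * (derive1 S y + mu_bar m)) (2^-1 * tip_force m (S x)).
Proof.
move=> /limit_ODE_is_derive[_ dS1 _ _]; have ? := dS1 x.
apply: is_derive_eqP; rewrite /GRing.scale/=; ring.
Qed.

Lemma limit_ODE_derive_odd (K : realType) (m x : K) (S : K -> K) : 1 < m ->
  limit_ODE m S -> derive1 S (- x) = - derive1 S x.
Proof.
move=> m1 HS; have even := limit_ODE_even m1 HS.
have [dS _ _ _] := limit_ODE_is_derive HS.
have h : is_derive (0 + -1 * x) 1 S (derive1 S (- x)) by rewrite add0r mulN1r; exact: dS.
have := is_derive1_comp_affine h.
have -> : (fun y => S (0 + -1 * y)) = S.
  by apply/funext => y; rewrite add0r mulN1r even.
by move=> [_ e]; rewrite [in RHS]derive1E e mulrN1 opprK.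
Qed.

(* At the left end of J the argument of R is -3/2: there R <= V(1), the slope
   of R is at most V(1), and V(1) <= Phi'(3/4) / sigma, where
   1 / sigma = e^(m+2) / mu^2. *)
Lemma base_T_left (K : realType) (m sigma mu : K) (V R : K -> K) :
  0 < m -> tip_scaling m V R sigma mu ->
  let X := (2 * mu)^-1 in let L := (1 - R 0) `^ (m + 1) in
  0 <= base_T mu R (- X) <= 4 * dPhi m (3 / 4) * (L * X ^+ 2) /\
  0 <= base_T1 mu V R (- X) <= 2 * dPhi m (3 / 4) * (L * X).
Proof.
move=> m0 HS X L; have [H mu0 muE] := HS; have /andP[e0 _] := wave_eps_itv H.
have s0 := wave_speed_gt0 H; have P0 := dPhi34_ge0 m0.
have X0 : 0 < X by rewrite invr_gt0 mulr_gt0.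
have muX : mu * - X = - 2^-1 by rewrite mulrN (scaling_half HS).
have V1 : V 1 <= dPhi m (3 / 4) / sigma.
  rewrite ler_pdivlMr// mulrC; apply: le_trans (wave_V_one H) _.
  by apply: le_dPhi => //; [exact: wave_R_half H|lra].
have LE : L = mu ^+ 2 / ((1 - R 0) * sigma) by rewrite (scaling_ratio HS).
have eX : 4 * dPhi m (3 / 4) * (L * X ^+ 2) = dPhi m (3 / 4) / sigma / (1 - R 0).
  by rewrite LE /X; field; rewrite !gt_eqF.
have eX1 : 2 * dPhi m (3 / 4) * (L * X) = mu / (1 - R 0) * (dPhi m (3 / 4) / sigma).
  by rewrite LE /X; field; rewrite !gt_eqF.
rewrite eX eX1 /base_T /base_T1 muX.
have -> : -1 - 2^-1 = - (3 / 2) :> K by field.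
have -> : - 2^-1 - 2^-1 = -1 :> K by field.
have -> : - (3 / 2) - 2^-1 = -2 :> K by field.
rewrite (wave_R_even H) !(wave_V_even H).
have /andP[R0 _] := wave_R_itv H (3 / 2).
have V12 : V 2 <= V 1 by apply: (wave_V_noninc H); lra.
have V2 := wave_V_ge0 H 2.
have R32 := wave_R_three_halves H.
split; apply/andP; split.
- by rewrite divr_ge0// ltW.
- by rewrite ler_pM2r ?invr_gt0//; lra.
- by rewrite mulr_ge0 ?divr_ge0 ?(ltW mu0) ?(ltW e0)//; lra.
- by rewrite ler_wpM2l ?divr_ge0 ?(ltW mu0) ?(ltW e0)//; lra.
Qed.

(** By parity T0(-x) = (u - x v)/2, with u the tail of [kappa_bar] and v the slope gap mu_bar -
    S'(x); both u and x v are O((1+x)^(1-m)). *)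
Lemma T_lim_left (K : realType) (m : K) (S : K -> K) : 1 < m -> limit_ODE m S ->
  exists2 C : K, 0 <= C & forall x : K, 0 <= x ->
    `|T_lim m S (- x)| <= C * (1 + x) `^ (1 - m) /\
    `|2^-1 * (derive1 S (- x) + mu_bar m)| <= C * (1 + x) `^ (- m).
Proof.
move=> m1 HS; have m0 : 0 < m by lra.
have [C0 C00 tail] := kappa_bar_tail m1 HS.
pose C1 := mu_bar m * growth_rate m `^ (- m).
have C10 : 0 <= C1 by rewrite mulr_ge0 ?powR_ge0// ltW// mu_bar_gt0.
exists (C0 + C1); first by rewrite addr_ge0.
move=> x x0; have x1 : 0 < 1 + x by lra.
have /andP[k1 k2] := tail _ x0; have /andP[s1 s2] := limit_ODE_slope_gap m1 HS x0.
rewrite -/C1 in s2.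
set u := kappa_bar S - _ in k1 k2; set v := mu_bar m - _ in s1 s2.
have E : (1 + x) `^ (1 - m) = (1 + x) `^ (- m) * (1 + x) 
  by rewrite (addrC 1 (- m)) powRD1.
have p0 : 0 <= (1 + x) `^ (- m) by exact: powR_ge0.
have p1 : 0 <= (1 + x) `^ (1 - m) by exact: powR_ge0.
split.
  have -> : T_lim m S (- x) = 2^-1 * (u - x * v).
    by rewrite /T_lim (limit_ODE_even m1 HS) /u /v; ring.
  have xv : x * v <= C1 * (1 + x) `^ (1 - m).
    have -> : C1 * (1 + x) `^ (1 - m) = (1 + x) * (C1 * (1 + x) `^ (- m)).
      by rewrite E; ring.
    by rewrite ler_pM//; lra.
  have xv0 : 0 <= x * v by rewrite mulr_ge0.
  rewrite mulrDl ler_norml; have := mulr_ge0 C00 p1; have := mulr_ge0 C10 p1.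
  by lra.
have -> : 2^-1 * (derive1 S (- x) + mu_bar m) = 2^-1 * v.
  by rewrite (limit_ODE_derive_odd x m1 HS) /v; ring.
rewrite ger0_norm ?mulr_ge0// mulrDl; have := mulr_ge0 C00 p0.
by lra.
Qed.

(** Half the tip force of the wave is separated exactly. Its distance to half the limit force is
    controlled on [0, X] by comparison and on the rest of J by evenness; what remains involves R
    only at distance at least 1/2 from 0. *)
Lemma base_T2_error (K : realType) (m : K) (S : K -> K) : 1 < m ->
  limit_ODE m S -> exists2 C : K, 0 <= C &
  forall (V R : K -> K) (sigma mu : K), tip_scaling m V R sigma mu ->
  forall x, - (2 * mu)^-1 <= x <= (2 * mu)^-1 ->
    `|base_T2 m mu R x - 2^-1 * tip_force m (S x)| <= C * (1 - R 0) `^ (m + 1).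
Proof.
move=> m1 HS; have m0 : 0 < m by lra.
have g0 := growth_rate_gt0 m0; have B0 := tip_error_gt0 m0; have P0 := dPhi34_ge0 m0.
have i0 : 0 <= (m + 1)^-1 by rewrite invr_ge0; lra.
have [c0 c00 apriori] := tip_apriori m1.
pose c := Num.min c0 (growth_rate m).
have c_gt0 : 0 < c by rewrite lt_min c00.
pose C1 := comparison_rate m c * expR (comparison_rate m c / m) * tip_error m.
have C10 : 0 <= C1 by rewrite !mulr_ge0 ?expR_ge0 ?powR_ge0// ltW.
pose C2 := (m + 1)^-1 + 3 * dPhi m (3 / 4).
have C20 : 0 <= C2 by exact: addr_ge0 i0 (mulr_ge0 (ler0n _ 3) P0).
exists (C1 + C2); first by rewrite addr_ge0.
move=> V R sigma mu HT x xX; have [H mu0 _] := HT; have /andP[e0 _] := wave_eps_itv H.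
have [_ growth] := apriori _ _ _ _ HT.
set L := (1 - R 0) `^ (m + 1); have L0 : 0 < L by rewrite powR_gt0.
set X := (2 * mu)^-1 in xX growth.
have compare y : 0 <= y <= X ->
    `|tip_force m (tip_S mu R y) - tip_force m (S y)| <= C1 * L.
  move=> yX; have eta0 : 0 < tip_error m * L by rewrite mulr_gt0.
  have [||_] := @tip_profile_compare _ m _ X c _ _ _ _ _ _ m0 eta0 c_gt0
    (tip_S_profile m0 HT) (limit_ODE_tip_profile X m0 HS) _ _ y yX.
  - move=> z zX; apply: le_trans (growth _ zX).
    by rewrite ler_wpM2r ?ge_min ?lexx//; lra.
  - move=> z zX.
    apply: le_trans (tip_profile_growth m1 (ltW g0) (limit_ODE_tip_profile X m0 HS) zX).
    by rewrite ler_wpM2r ?ge_min ?lexx ?orbT//; lra.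
  - by rewrite /C1 -!mulrA.
have {}compare : `|tip_force m (tip_S mu R x) - tip_force m (S x)| <= C1 * L.
  case: (leP 0 x) => [x0|x0]; first by apply: compare; lra.
  rewrite -(tip_S_even mu x H) -(limit_ODE_even m1 HS x); apply: compare; lra.
rewrite (tip_force_tip_S _ _ m0 H) -/L in compare.
have muX := scaling_half HT; rewrite -/X in muX.
have mux1 : mu * x <= 2^-1 by rewrite -muX ler_pM2l//; lra.
have mux2 : - 2^-1 <= mu * x by rewrite -muX -mulrN ler_pM2l//; lra.
have n1 : 2^-1 <= `|-1 + mu * x| by rewrite ler0_norm; lra.
have n2 : 2^-1 <= `|-2 + mu * x| by rewrite ler0_norm; lra.
have /andP[P1 P1'] := wave_dPhi_bounds m0 H n1.
have /andP[P2 P2'] := wave_dPhi_bounds m0 H n2.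
rewrite /base_T2 -/L.
set p0 := dPhi m (R (mu * x)) in compare *; set p1 := dPhi m (R (-1 + mu * x)) in P1 P1' *.
set p2 := dPhi m (R (-2 + mu * x)) in P2 P2' *; set f := tip_force m (S x) in compare *.
have -> : L * (p0 - 2 * p1 + p2) - 2^-1 * f =
    2^-1 * (L * (2 * p0 + 2 / (m + 1)) - f) + L * (- (m + 1)^-1 - 2 * p1 + p2).
  by field; lra.
apply: le_trans (ler_normD _ _) _; rewrite [leRHS]mulrDl; apply: lerD.
  rewrite normrM ger0_norm//; apply: le_trans compare; rewrite ler_piMl//; lra.
rewrite normrM (gtr0_norm L0) [leRHS]mulrC ler_wpM2l ?(ltW L0)//.
by rewrite ler_norml /C2; lra.
Qed.

Lemma base_estimate (K : realType) (m : K) (S : K -> K) : 1 < m ->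
  limit_ODE m S -> exists C : K,
  forall (V R : K -> K) (sigma mu : K), tip_scaling m V R sigma mu ->
  forall x, - (2 * mu)^-1 <= x <= (2 * mu)^-1 ->
    (1 - R 0) ^+ 2 * `|base_T mu R x - T_lim m S x| +
    (1 - R 0) * `|base_T1 mu V R x - 2^-1 * (derive1 S x + mu_bar m)| +
    `|base_T2 m mu R x - 2^-1 * tip_force m (S x)| <= C * (1 - R 0) `^ (m + 1).
Proof.
move=> m1 HS; have m0 : 0 < m by lra.
have P0 := dPhi34_ge0 m0.
have [c c0 apriori] := tip_apriori m1.
have [Ca Ca0 T2err] := base_T2_error m1 HS.
have [Cl Cl0 Tleft] := T_lim_left m1 HS.
pose Cd := c `^ (- m) / c.
have Cd0 : 0 <= Cd by rewrite divr_ge0 ?powR_ge0// ltW.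
pose A := Ca + 4 * dPhi m (3 / 4) + Cl * Cd.
have A0 : 0 <= A by rewrite !addr_ge0// mulr_ge0.
(* With Y = 1 + X, a point of J is within 2 Y of its left end: the slope error is at most 1 + 2 = 3
   times A L Y, the error of T at most 1 + 2 * 3 = 7 times A L Y^2. The powers of 1/c come from eps
   Y <= 1/c. *)
exists (A * (7 * (c^-1) ^+ 2 + 3 * c^-1 + 1)).
move=> V R sigma mu HT x xX; have [H mu0 _] := HT; have /andP[e0 e1] := wave_eps_itv H.
have [/andP[Yge Yle] _] := apriori _ _ _ _ HT.
have [/andP[t0 t0'] /andP[t1 t1']] := base_T_left m0 HT.
have {T2err} dT2 y : - (2 * mu)^-1 <= y <= (2 * mu)^-1 -> _ := T2err V R sigma mu HT y.
set L := (1 - R 0) `^ (m + 1) in t0' t1' dT2 *.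
have L0 : 0 < L by rewrite powR_gt0.
have X0 : 0 < (2 * mu)^-1 by rewrite invr_gt0 mulr_gt0.
have [l0 l1] := Tleft _ (ltW X0).
set X := (2 * mu)^-1 in Yge Yle t0 t0' t1 t1' dT2 X0 l0 l1 xX.
pose e := 1 - R 0; rewrite -/e in e0 e1 Yge Yle *.
pose Y := 1 + X; rewrite -/Y in Yge Yle l0 l1.
have Y0 : 0 < Y by rewrite /Y; lra.
(* Since eps Y >= c, the decay Y^-m of the limit profile is of order eps^m at most, and L Y is at
   least of that order. So the limit and the wave have left-end errors of matching form. *)
have Ym : Y `^ (- m) <= Cd * (L * Y).
  have -> : L = e `^ m * e by rewrite /L powRD1.
  have h1 : c * e^-1 <= Y by rewrite ler_pdivrMr// mulrC.
  have h2 : 0 < c * e^-1 by rewrite mulr_gt0 ?invr_gt0.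
  apply: le_trans (le_powRN (ltW m0) h2 h1) _.
  rewrite powRM ?(ltW c0) ?invr_ge0 ?(ltW e0)//.
  have -> : e^-1 `^ (- m) = e `^ m.
    by rewrite -powR_inv1 ?(ltW e0)// -powRrM mulrNN mul1r.
  have -> : Cd * (e `^ m * e * Y) = c `^ (- m) * e `^ m * ((e * Y) / c).
    by rewrite /Cd; ring.
  by rewrite ler_peMr ?mulr_ge0 ?powR_ge0// ler_pdivlMr// mul1r.
have AE Z : A * Z = Ca * Z + 4 * (dPhi m (3 / 4) * Z) + Cl * (Cd * Z) by rewrite /A; ring.
have CaA : Ca <= A.
  have := mulr_ge0 Cl0 Cd0; rewrite /A; lra.
have XY : X <= Y by rewrite /Y; lra.
clearbody A Y L Cd.
have X2Y : X ^+ 2 <= Y ^+ 2 by rewrite lerXn2r ?nnegrE ?(ltW X0) ?(ltW Y0).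
have LY0 : 0 <= L * Y by rewrite mulr_ge0 ?(ltW L0) ?(ltW Y0).
have LY20 : 0 <= L * Y ^+ 2 by rewrite mulr_ge0 ?exprn_ge0 ?(ltW L0) ?(ltW Y0).
have left1 : `|base_T1 mu V R (- X) - 2^-1 * (derive1 S (- X) + mu_bar m)| <= A * (L * Y).
  apply: le_trans (ler_normB _ _) _; rewrite (ger0_norm t1).
  have h1 : dPhi m (3 / 4) * (L * X) <= dPhi m (3 / 4) * (L * Y).
    by rewrite ler_wpM2l// ler_pM2l.
  have h2 := ler_wpM2l Cl0 Ym.
  have h3 := mulr_ge0 Ca0 LY0; have h4 := mulr_ge0 P0 LY0.
  by rewrite AE; lra.
have left0 : `|base_T mu R (- X) - T_lim m S (- X)| <= A * (L * Y ^+ 2).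
  apply: le_trans (ler_normB _ _) _; rewrite (ger0_norm t0).
  have h1 : dPhi m (3 / 4) * (L * X ^+ 2) <= dPhi m (3 / 4) * (L * Y ^+ 2).
    by rewrite ler_wpM2l// ler_pM2l.
  have h2 : Cl * Y `^ (1 - m) <= Cl * (Cd * (L * Y ^+ 2)).
    rewrite (addrC 1 (- m)) powRD1// ler_wpM2l//.
    have -> : Cd * (L * Y ^+ 2) = Cd * (L * Y) * Y by ring.
    by rewrite ler_pM2r.
  have h3 := mulr_ge0 Ca0 LY20; have h4 := mulr_ge0 P0 LY20.
  by rewrite AE; lra.
have dT2A y : - X <= y <= X -> `|base_T2 m mu R y - 2^-1 * tip_force m (S y)| <= A * L.
  by move=> yX; apply: le_trans (dT2 _ yX) _; rewrite ler_pM2r.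
have AL0 : 0 <= A * L by rewrite mulr_ge0// ltW.
have dT1 y : - X <= y <= X ->
    `|base_T1 mu V R y - 2^-1 * (derive1 S y + mu_bar m)| <= 3 * (A * L) * Y.
  move=> yX.
  have := @increment_norm_le_cst _
    (fun z => base_T1 mu V R z - 2^-1 * (derive1 S z + mu_bar m))
    (fun z => base_T2 m mu R z - 2^-1 * tip_force m (S z)) (- X) y (A * L).
  set d := base_T1 mu V R y - _; set d0 := base_T1 mu V R (- X) - _.
  move=> h.
  have {}h : `|d - d0| <= A * L * (y - - X).
    apply: h => [|z zX|z zX]; [lra| |by apply: dT2A; lra].
    have ? := is_derive_base_T1 z HT; have ? := is_derive_T_lim1 z HS.
    exact: is_deriveB.
  have h2 : A * L * (y - - X) <= A * L * (2 * Y) by rewrite ler_wpM2l//; lra.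
  have : `|d| <= `|d - d0| + `|d0| by rewrite -{1}(subrK d0 d) ler_normD.
  by move: left1; rewrite -/d0; lra.
have ALY0 : 0 <= 3 * (A * L) * Y by rewrite !mulr_ge0 ?(ltW L0) ?(ltW Y0).
have dT0 : `|base_T mu R x - T_lim m S x| <= 7 * (A * L) * Y ^+ 2.
  have := @increment_norm_le_cst _
    (fun z => base_T mu R z - T_lim m S z)
    (fun z => base_T1 mu V R z - 2^-1 * (derive1 S z + mu_bar m)) (- X) x
    (3 * (A * L) * Y).
  set d := base_T mu R x - _; set d0 := base_T mu R (- X) - _.
  move=> h.
  have {}h : `|d - d0| <= 3 * (A * L) * Y * (x - - X).
    apply: h => [|z zX|z zX]; [lra| |by apply: dT1; lra].
    have ? := is_derive_base_T z HT; have ? := is_derive_T_lim z HS.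
    exact: is_deriveB.
  have h2 : 3 * (A * L) * Y * (x - - X) <= 3 * (A * L) * Y * (2 * Y).
    by rewrite ler_wpM2l//; lra.
  have : `|d| <= `|d - d0| + `|d0| by rewrite -{1}(subrK d0 d) ler_normD.
  by move: left0; rewrite -/d0; lra.
have eY0 : 0 <= e * Y by rewrite mulr_ge0 ?(ltW e0) ?(ltW Y0).
have h0 := ler_wpM2l (sqr_ge0 e) dT0; have h1 := ler_wpM2l (ltW e0) (dT1 _ xX).
have h2 := dT2A _ xX.
have s1 : A * L * (e * Y) <= A * L * c^-1 by rewrite ler_wpM2l.
have s2 : A * L * (e * Y) ^+ 2 <= A * L * (c^-1) ^+ 2.
  by rewrite ler_wpM2l// lerXn2r// nnegrE ?invr_ge0 ltW.
have g0 : e ^+ 2 * (7 * (A * L) * Y ^+ 2) = 7 * (A * L * (e * Y) ^+ 2) by ring.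
have g1 : e * (3 * (A * L) * Y) = 3 * (A * L * (e * Y)) by ring.
have -> : A * (7 * (c^-1) ^+ 2 + 3 * c^-1 + 1) * L =
  7 * (A * L * (c^-1) ^+ 2) + 3 * (A * L * c^-1) + A * L by ring.
rewrite g0 in h0; rewrite g1 in h1.
apply: (@le_trans _ _ (7 * (A * L * (e * Y) ^+ 2) + 3 * (A * L * (e * Y)) + A * L)).
  exact: lerD (lerD h0 h1) h2.
by rewrite !lerD// ler_wpM2l.
Qed.

(** * Conclusion for the family *)

Lemma high_energy_scaling (K : realType) (m : K) (V R : K -> K -> K)
    (sigma : K -> K) (d : K) : 0 < m -> high_energy_family m V R sigma -> 0 < d < 1 ->
  tip_scaling m (V d) (R d) (sigma d) (mu m R sigma d).
Proof.
move=> m0 [H _] d01; have [HW HV HR nV R01] := H _ d01.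
have s0 : 0 < sigma d by case: HW.
have c1 : 0 < 1 - d <= 1 by lra.
have HF := solitary_wave_facts m0 HW HV HR c1 nV R01.
have /andP[e0 _] := wave_eps_itv HF.
have p0 : 0 < sigma d * eps R d `^ (m + 2) by rewrite mulr_gt0 ?powR_gt0.
by split=> //; [rewrite sqrtr_gt0|rewrite sqr_sqrtr// ltW].
Qed.

Unset Implicit Arguments.

Theorem theorem15 (K : realType) (m : K) (V R : K -> K -> K) (sigma : K -> K)
    (S0 : K -> K) :
  1 < m ->
  high_energy_family m V R sigma ->
  limit_ODE m S0 ->
  (exists C : K, forall d : K, 0 < d < 1 ->
     (ereal_sup
        [set (eps R d ^+ 2 * `|T_resc m R sigma d x - T_lim m S0 x|
              + eps R d * `|derive1 (T_resc m R sigma d) x - derive1 (T_lim m S0) x|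
              + `|derive1n 2 (T_resc m R sigma d) x - derive1n 2 (T_lim m S0) x|)%:E
        | x in J m R sigma d]
      <= (C * eps R d `^ (m + 1))%:E)%E) /\
  (exists C : K, forall d : K, 0 < d < 1 ->
     `|R d 1 - 2^-1 * kappa_bar S0 * eps R d| <= C * eps R d `^ m /\
     `|R d (-1) - 2^-1 * kappa_bar S0 * eps R d| <= C * eps R d `^ m).
Proof.
move=> m1 HE HS; have m0 : 0 < m by lra.
have [C est] := base_estimate m1 HS.
have L1 : derive1 (T_lim m S0) = (fun x => 2^-1 * (derive1 S0 x + mu_bar m)).
  by apply/funext => x; have [_ e] := is_derive_T_lim x HS; rewrite derive1E.
have L2 : derive1n 2 (T_lim m S0) = (fun x => 2^-1 * tip_force m (S0 x)).
  apply/funext => x; have [_ e] := is_derive_T_lim1 x HS.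
  by rewrite /derive1n/= L1 derive1E.
have bound d x : 0 < d < 1 -> - (2 * mu m R sigma d)^-1 <= x <= (2 * mu m R sigma d)^-1 ->
    eps R d ^+ 2 * `|T_resc m R sigma d x - T_lim m S0 x|
      + eps R d * `|derive1 (T_resc m R sigma d) x - derive1 (T_lim m S0) x|
      + `|derive1n 2 (T_resc m R sigma d) x - derive1n 2 (T_lim m S0) x|
    <= C * eps R d `^ (m + 1).
  move=> d01 xJ; have HT := high_energy_scaling m0 HE d01.
  have TE : T_resc m R sigma d = base_T (mu m R sigma d) (R d) by [].
  have D1 : derive1 (base_T (mu m R sigma d) (R d)) = base_T1 (mu m R sigma d) (V d) (R d).
    by apply/funext => y; have [_ e] := is_derive_base_T y HT; rewrite derive1E.
  have D2 : derive1n 2 (base_T (mu m R sigma d) (R d)) x =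
      base_T2 m (mu m R sigma d) (R d) x.
    by have [_ e] := is_derive_base_T1 x HT; rewrite /derive1n/= D1 derive1E.
  by rewrite TE D1 D2 L1 L2; exact: est HT x xJ.
split; exists C => d d01.
  by apply: ge_ereal_sup => _ [x xJ <-]; rewrite lee_fin; apply: bound.
have HT := high_energy_scaling m0 HE d01; have [HF mu0 _] := HT.
have /andP[e0 _] := wave_eps_itv HF; rewrite -/(eps R d) in e0.
(* The rescaled point 0 corresponds to -1, and T0(0) = kappa_bar / 2. *)
have J0 : - (2 * mu m R sigma d)^-1 <= 0 <= (2 * mu m R sigma d)^-1.
  by rewrite oppr_le0 invr_ge0 mulr_ge0// ltW.
have := bound _ _ d01 J0; rewrite (powRD1 _ e0) => h.
have {h} : eps R d ^+ 2 * `|T_resc m R sigma d 0 - T_lim m S0 0|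
    <= C * (eps R d `^ m * eps R d).
  by apply: le_trans h; rewrite -addrA lerDl addr_ge0// mulr_ge0// ltW.
(* R(-1) is eps times T(0), which uses one of the two factors eps; the other is cancelled against
   eps^(m+1) and leaves eps^m. *)
have -> : eps R d ^+ 2 * `|T_resc m R sigma d 0 - T_lim m S0 0| =
    `|R d (-1) - 2^-1 * kappa_bar S0 * eps R d| * eps R d.
  have [_ _ S00 _] := limit_ODE_is_derive HS.
  rewrite /T_resc /T_lim S00 !mulr0 !add0r addr0 expr2 -mulrA mulrC; congr (_ * _).
  by rewrite -{1}(gtr0_norm e0) -normrM; congr `|_|; field; rewrite gt_eqF.
rewrite mulrA ler_pM2r// => h; split=> //.
by rewrite -(wave_R_even HF).
Qed.
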